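(* Let $\mathcal R$ be a unital ring and let $i:N\rightarrow M$ be a pure embedding of right $\mathcal R$-modules such that the theory of $M$ satisfies $Th(M)=Th(M)^{\aleph_0}$. Then $i$ induces a surjective ring homomorphism $I:K_0(M)\twoheadrightarrow K_0(N)$.
   Context: **pp-definable subgroups.** A right $\mathcal R$-module $M$ is viewed as a first order structure in the language $\langle 0,+,-,m_r: r\in\mathcal R\rangle$, where $m_r$ is right multiplication by $r$; ''definable'' means definable with parameters from the module. A parameter-free pp-formula is a formula equivalent to one of the form $\exists y_1\dots\exists y_m\bigwedge_{l=1}^t\left(\sum_j x_jr_{lj}+\sum_k y_ks_{lk}=0\right)$ with $r_{lj},s_{lk}\in\mathcal R$; such a formula in $n$ free variables defines a subgroup of $M^n$, called a pp-definable subgroup. $\mathcal L_n^\circ(M)$ denotes the set of all pp-definable subgroups of $M^n$. **Pure embedding.** A submodule $N\leq M$ is called a pure submodule if, for each $n$, $A\cap N^n\in\mathcal L_n^\circ(N)$ for every $A\in\mathcal L_n^\circ(M)$. A monomorphism $i:N\to M$ is a pure monomorphism (pure embedding) if $iN$ is a pure submodule of $M$. **The condition $Th(M)=Th(M)^{\aleph_0}$** means $M\equiv M^{(\aleph_0)}$ (the direct sum of countably many copies of $M$); equivalently, for every $n\ge1$ and all pp-definable subgroups $A,B$ of $M^n$, the index $[A:A\cap B]$ is $1$ or infinite. **Grothendieck ring.** Two definable sets $A\subseteq M^n$, $B\subseteq M^m$ ($n,m\ge 1$) are definably isomorphic if there is a bijection $A\to B$ with definable graph; $[A]$ denotes the equivalence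 class. The set $\widetilde{\mathrm{Def}}(M)$ of all classes is a commutative semiring with $0=[\emptyset]$, $1=[\text{singleton}]$, $[A]+[B]=[A'\sqcup B']$ for disjoint $A'\in[A]$, $B'\in[B]$, and $[A]\cdot[B]=[A\times B]$. $K_0(M)$ is the Grothendieck ring of this semiring, i.e. the commutative ring with a semiring homomorphism from $\widetilde{\mathrm{Def}}(M)$ through which every semiring homomorphism from $\widetilde{\mathrm{Def}}(M)$ to a commutative ring factors uniquely.
   Formalization: ''Pure'' is taken in the standard sense: for each pp-formula, the subgroup it defines in M^n meets N^n in the subgroup it defines in N^n; asking only that A∩N^n be some pp-definable subgroup makes the claim false (e.g. an affine elliptic curve's coordinate ring in its fraction field). *)

(* Defs.v *)
From HB Require Import structures.
From mathcomp Require Import all_boot all_algebra generic_quotient.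
From mathcomp Require Import boolp classical_sets functions cardinality ring.

Set Implicit Arguments.
Unset Strict Implicit.
Unset Printing Implicit Defensive.

Import GRing.Theory.

Local Open Scope ring_scope.
Local Open Scope quotient_scope.
Local Open Scope classical_set_scope.

(* A right [R]-module is a left module over the converse ring [R^c], so that
   [x r] is written [(r : R^c) *: x]. *)

Section Language.
Variable R : pzRingType.

(* Terms and formulas in [n] free variables over the language
   <0, +, -, m_r : r in R> expanded by constants from [C]. *)
Inductive term (C : Type) (n : nat) : Type :=
| Var of 'I_n
| Cst of C
| Zero
| Add of term C n & term C n
| Opp of term C n
| Act of term C n & R.

(* In [Ex f] the bound variable is the variable 0 of [f]. *)
Inductive formula (C : Type) : nat -> Type :=
| Eq n of term C n & term C n : formula C n
| Not n of formula C n : formula C n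
| And n of formula C n & formula C n : formula C n
| Ex n of formula C (1 + n) : formula C n.

Section Semantics.
Variables (M : lmodType R^c) (C : Type) (c : C -> M).

Fixpoint eval n (e : 'rV[M]_n) (t : term C n) : M :=
  match t with
  | Var i => e 0 i
  | Cst a => c a
  | Zero => 0
  | Add t u => eval e t + eval e u
  | Opp t => - eval e t
  | Act t r => (r : R^c) *: eval e t
  end.

Fixpoint holds n (f : formula C n) : 'rV[M]_n -> Prop :=
  match f with
  | Eq _ t u => fun e => eval e t = eval e u
  | Not _ f => fun e => ~ holds f e
  | And _ f g => fun e => holds f e /\ holds g e
  | Ex _ f => fun e => exists a : M, holds f (row_mx (const_mx a : 'rV_1) e)
  end.

End Semantics.

Definition definable (M : lmodType R^c) n (A : set 'rV[M]_n) : Prop :=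
  exists f : formula M n, A = [set x | holds id f x].

Definition theory (M : lmodType R^c) : set (formula void 0) :=
  [set f | holds (of_void M) f 0].

(* The pp-formula "exists y_1 .. y_m, /\_l sum_j x_j r_lj + sum_k y_k s_lk = 0"
   in the free variables x_1 .. x_n. *)
Record ppformula (n : nat) := PPFormula {
  pp_nbound : nat;
  pp_neqns : nat;
  pp_free : 'M[R]_(pp_neqns, n);
  pp_bound : 'M[R]_(pp_neqns, pp_nbound) }.

Definition ppset (M : lmodType R^c) n (f : ppformula n) : set 'rV[M]_n :=
  [set x | exists y : 'rV[M]_(pp_nbound f), forall l,
     \sum_j (pp_free f l j : R^c) *: x 0 j +
     \sum_k (pp_bound f l k : R^c) *: y 0 k = 0].

Arguments ppset M {n} f.

Definition ppdefinable (M : lmodType R^c) n (A : set 'rV[M]_n) : Prop :=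
  exists f : ppformula n, A = ppset M f.

(* Identifying [N] with its image: A `&` N^n is the pp-definable subgroup of
   [N^n] given by the same pp-formula as A, for every pp-definable A.  It would
   not be enough to ask that A `&` N^n be given by some pp-formula: that
   would make every commutative domain pure in its fraction field. *)
Definition pure (N M : lmodType R^c) (i : {linear N -> M}) : Prop :=
  injective i /\
  forall n (f : ppformula n), map_mx i @^-1` ppset M f = ppset N f.

End Language.

Arguments Var {R C n}.
Arguments Cst {R C n}.
Arguments Zero {R C n}.
Arguments ppset {R} M {n} f.

Section CountablePower.
Variables (R : pzRingType) (M : lmodType R).

Definition finsupp : {pred nat -> M} :=
  fun u => `[< finite_set [set k | u k != 0] >].

Lemma finsupp_submod : submod_closed finsupp.
Proof.
split=> [|r u v /asboolP fu /asboolP fv]; apply/asboolP.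
  by rewrite (_ : [set _ | _] = set0) // -subset0 => k /=; rewrite eqxx.
apply: sub_finite_set
  (_ : finite_set ([set k | u k != 0] `|` [set k | v k != 0])).
  move=> k /=; apply: contraPP.
  move=> /not_orP[/negP/negPn/eqP uk /negP/negPn/eqP vk].
  apply/negP/negPn/eqP; rewrite /= {1}/GRing.add /= {1}/GRing.scale /=.
  by rewrite uk vk scaler0 addr0.
by rewrite finite_setU.
Qed.

HB.instance Definition _ :=
  GRing.isSubmodClosed.Build R (nat -> M) finsupp
    finsupp_submod.

(* M^(aleph_0), the direct sum of countably many copies of M, as the module
   of finitely supported sequences *)
Record cpower := CPower { cpower_val :> nat -> M; _ : cpower_val \in finsupp }.
HB.instance Definition _ := [isSub for cpower_val].
HB.instance Definition _ := [Choice of cpower by <:].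
HB.instance Definition _ := [SubChoice_isSubLmodule of cpower by <:].

End CountablePower.

Section Definable.
Variables (R : pzRingType) (M : lmodType R^c).

Definition lift_ren n m (p : 'I_n -> 'I_m) (i : 'I_(1 + n)) : 'I_(1 + m) :=
  match fintype.split i with inl j => lshift m j | inr j => rshift 1 (p j) end.

Fixpoint ren_term C n m (p : 'I_n -> 'I_m) (t : term R C n) : term R C m :=
  match t with
  | Var i => Var (p i)
  | Cst a => Cst a
  | Zero => Zero
  | Add t u => Add (ren_term p t) (ren_term p u)
  | Opp t => Opp (ren_term p t)
  | Act t r => Act (ren_term p t) r
  end.

Fixpoint ren C n (f : formula R C n) :
    forall m, ('I_n -> 'I_m) -> formula R C m :=
  match f with
  | Eq _ t u => fun m p => Eq (ren_term p t) (ren_term p u)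
  | Not _ f => fun m p => Not (ren f p)
  | And _ f g => fun m p => And (ren f p) (ren g p)
  | Ex _ f => fun m p => Ex (ren f (lift_ren p))
  end.

Lemma eval_ren C (c : C -> M) n m (p : 'I_n -> 'I_m) (e : 'rV[M]_m)
    (t : term R C n) : eval c e (ren_term p t) = eval c (colsub p e) t.
Proof. by elim: t => //= [i|t -> u ->|t ->|t -> r] //; rewrite mxE. Qed.

Lemma colsub_lift n m (p : 'I_n -> 'I_m) (a : 'rV[M]_1) (e : 'rV[M]_m) :
  colsub (lift_ren p) (row_mx a e) = row_mx a (colsub p e).
Proof.
apply/rowP => i; rewrite !mxE /lift_ren; case: (splitP i) => j _.
  by rewrite (unsplitK (inl j)).
by rewrite (unsplitK (inr (p j))) mxE.
Qed.

Lemma holds_ren C (c : C -> M) n (f : formula R C n) m (p : 'I_n -> 'I_m)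
    (e : 'rV[M]_m) : holds c (ren f p) e <-> holds c f (colsub p e).
Proof.
elim: f m p e => {n} [n t u|n f ihf|n f ihf g ihg|n f ihf] m p e /=.
- by rewrite !eval_ren.
- by rewrite ihf.
- by rewrite ihf ihg.
by split=> -[a fa]; exists a; move: fa; rewrite ihf colsub_lift.
Qed.

Lemma definableC n (A : set 'rV[M]_n) : definable A -> definable (~` A).
Proof. by case=> f ->; exists (Not f). Qed.

Lemma definableI n (A B : set 'rV[M]_n) :
  definable A -> definable B -> definable (A `&` B).
Proof. by case=> f -> [g ->]; exists (And f g). Qed.

Lemma definableU n (A B : set 'rV[M]_n) :
  definable A -> definable B -> definable (A `|` B).
Proof.
by move=> dA dB; rewrite -[_ `|` _]setCK setCU;
  apply/definableC/definableI; apply: definableC.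
Qed.

Lemma definableT n : definable [set: 'rV[M]_n].
Proof. by exists (Eq Zero Zero); apply/seteqP; split. Qed.

Lemma definable0 n : definable (set0 : set 'rV[M]_n).
Proof. by rewrite -setCT; apply: definableC; apply: definableT. Qed.

Lemma definable_sub n m (p : 'I_n -> 'I_m) (A : set 'rV[M]_n) :
  definable A -> definable [set x | A (colsub p x)].
Proof.
case=> f ->; exists (ren f p).
by apply/seteqP; split=> x /=; rewrite holds_ren.
Qed.

Lemma definable_all n (I : finType) (A : I -> set 'rV[M]_n) :
  (forall i, definable (A i)) -> definable [set x | forall i, A i x].
Proof.
move=> dA.
have : definable [set x | forall i, i \in enum I -> A i x].
  elim: (enum I) => [|i s ih].
    by rewrite (_ : [set _ | _] = setT);
      [apply: definableT|apply/seteqP; split].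
  rewrite (_ : [set _ | _] = A i `&` [set x | forall i, i \in s -> A i x]).
    exact: definableI.
  apply/seteqP; split=> x /= => [h|[ai h] j]; last first.
    by rewrite inE => /orP[/eqP ->//|/h].
  by split=> [|j js]; apply: h; rewrite inE ?eqxx ?js ?orbT.
congr definable; apply/seteqP; split=> x /= h i; last by move=> _; apply: h.
by apply: h; rewrite mem_enum.
Qed.

Lemma definable_eqs n k (p q : 'I_k -> 'I_n) :
  definable [set x : 'rV[M]_n | colsub p x = colsub q x].
Proof.
have := @definable_all n 'I_k (fun j => [set x | x 0 (p j) = x 0 (q j)]).
rewrite (_ : [set x | colsub p x = _] =
             [set x | forall i, x 0 (p i) = x 0 (q i)]).
  by apply=> i; exists (Eq (Var (p i)) (Var (q i))).
apply/seteqP; split=> x /= h; last by apply/rowP => i; rewrite !mxE.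
by move=> i; have /rowP/(_ i) := h; rewrite !mxE.
Qed.

Lemma definable_pt n (a : 'rV[M]_n) : definable [set a].
Proof.
have := @definable_all n 'I_n (fun j => [set x | x 0 j = a 0 j]).
rewrite (_ : [set a] = [set x | forall i, x 0 i = a 0 i]).
  by apply=> i; exists (Eq (Var i) (Cst (a 0 i))).
by apply/seteqP; split=> x /= => [->//|h]; apply/rowP => i.
Qed.


Lemma definable_ex n m (A : set 'rV[M]_(n + m)) :
  definable A -> definable [set x | exists y, A (row_mx x y)].
Proof.
elim: m n A => [|m ih] n A dA.
  rewrite (_ : [set _ | _] =
    [set x | A (colsub (fun i => cast_ord (addn0 n) i) x)]).
    exact: definable_sub.
  have e (x : 'rV[M]_n) (y : 'rV_0) :
      row_mx x y = colsub (fun i => cast_ord (addn0 n) i) x.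
    apply/rowP => i; rewrite !mxE; case: splitP => [j ij|[]//].
    by congr (x _ _); apply: val_inj.
  by apply/seteqP; split=> x /=; [case=> y; rewrite e|exists 0; rewrite e].
pose s (i : 'I_(n + m.+1)) : 'I_((1 + n) + m) :=
  match fintype.split i with
  | inl j => lshift m (rshift 1 j)
  | inr j => match fintype.split (j : 'I_(1 + m)) with
             | inl k => lshift m (lshift n k)
             | inr k => rshift (1 + n) k end end.
have /ih[f fP] := @definable_sub _ _ s _ dA.
exists (Ex f); apply/seteqP; split=> x /=; last first.
  case=> a; move: fP => /(congr1 (@^~ (row_mx (const_mx a : 'rV_1) x))) /= <-.
  case=> y Ay; exists (row_mx (const_mx a : 'rV_1) y : 'rV_(1 + m)).
  move: Ay; congr A; apply/rowP => i; rewrite [LHS]mxE [RHS]mxE /s.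
  case: (splitP i) => j _; first by rewrite row_mxEl row_mxEr.
  rewrite [RHS]mxE; case: (splitP (j : 'I_(1 + m))) => k _.
    by rewrite row_mxEl row_mxEl.
  by rewrite row_mxEr.
case=> y Ay; exists (y 0 0).
move: fP => /(congr1 (@^~ (row_mx (const_mx (y 0 0) : 'rV_1) x))) /= <-.
exists (rsubmx (y : 'rV_(1 + m))); move: Ay; congr A.
apply/rowP => i; rewrite [LHS]mxE [RHS]mxE /s.
case: (splitP i) => j _; first by rewrite row_mxEl row_mxEr.
rewrite -[y in LHS](@hsubmxK _ 1 1 m) [LHS]mxE.
case: (splitP (j : 'I_(1 + m))) => k _.
  rewrite row_mxEl row_mxEl !mxE; congr (y _ _); apply: val_inj.
  by rewrite /= [k]ord1.
by rewrite row_mxEr.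
Qed.

Lemma definable_comp2 n m k (p : 'I_n -> 'I_k) (q : 'I_m -> 'I_k)
    (A : set 'rV[M]_(n + m)) :
  definable A -> definable [set x | A (row_mx (colsub p x) (colsub q x))].
Proof.
move=> dA.
pose s i := match fintype.split i with inl j => p j | inr j => q j end.
have := definable_sub s dA; congr definable; congr mkset.
apply/funext => x; congr A.
by apply/rowP => i; rewrite !mxE /s; case: splitP => j _; rewrite mxE.
Qed.

Lemma ppset_definable n (f : ppformula R n) : definable (ppset M f).
Proof.
case: f => m t r s; rewrite /ppset /=.
pose A := [set z : 'rV[M]_(n + m) | forall l,
  \sum_j (r l j : R^c) *: z 0 (lshift m j) +
  \sum_k (s l k : R^c) *: z 0 (rshift n k) = 0].
have /definable_ex : definable A.
  apply: definable_all => l.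
  pose T k (g : 'I_k -> R) (p : 'I_k -> 'I_(n + m)) : term R M (n + m) :=
    \big[@Add R M (n + m)/Zero]_(i < k) Act (Var (p i)) (g i).
  have TE k g p z : eval id z (@T k g p) = \sum_i (g i : R^c) *: z 0 (p i).
    by rewrite /T; apply: (big_morph (eval id z)).
  exists (Eq (Add (T _ (r l) (lshift m)) (T _ (s l) (@rshift n m))) Zero).
  by apply/seteqP; split=> z /=; rewrite !TE.
have e x y l :
    \sum_j (r l j : R^c) *: (row_mx x y : 'rV[M]_(n + m)) 0 (lshift m j) +
    \sum_k (s l k : R^c) *: (row_mx x y : 'rV[M]_(n + m)) 0 (rshift n k) =
    \sum_j (r l j : R^c) *: x 0 j + \sum_k (s l k : R^c) *: y 0 k.
  by congr (_ + _); apply: eq_bigr => i _; rewrite ?row_mxEl ?row_mxEr.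
congr definable; apply/seteqP; split=> x /= -[y h]; exists y => l;
  by move: (h l); rewrite e.
Qed.

End Definable.

Section Grothendieck.
Variable S : comPzSemiRingType.
Implicit Types (a b k : S) (x y z : S * S).

(* [(a, b)] stands for the formal difference [a - b]; [k] is needed because
   addition in [S] need not be cancellative. *)
Definition groth_eqv x y : bool :=
  `[< exists k, x.1 + y.2 + k = y.1 + x.2 + k >].

Lemma groth_eqv_refl : reflexive groth_eqv.
Proof. by move=> x; apply/asboolP; exists 0. Qed.

Lemma groth_eqv_sym : symmetric groth_eqv.
Proof.
by move=> x y; apply/asboolP/asboolP => -[k e]; exists k; rewrite e.
Qed.

Lemma groth_eqv_trans : transitive groth_eqv.
Proof.
move=> y x z /asboolP[k e] /asboolP[l f]; apply/asboolP.
exists (y.1 + y.2 + k + l).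
transitivity ((x.1 + y.2 + k) + (y.1 + z.2 + l)); first by ring.
by rewrite e f; ring.
Qed.

Canonical groth_equiv :=
  EquivRel groth_eqv groth_eqv_refl groth_eqv_sym groth_eqv_trans.

Definition groth := {eq_quot groth_eqv}.
HB.instance Definition _ : EqQuotient _ groth_eqv groth := EqQuotient.on groth.
HB.instance Definition _ := Choice.on groth.

Definition gdiff a b : groth := \pi_groth (a, b).

Lemma gdiffP a b c d :
  gdiff a b = gdiff c d <-> exists k, a + d + k = c + b + k.
Proof. by split=> [/eqmodP/asboolP|h]; last by apply/eqmodP/asboolP. Qed.

Lemma gdiffE (u : groth) : u = gdiff (repr u).1 (repr u).2.
Proof. by rewrite /gdiff -surjective_pairing reprK. Qed.

Definition gzero : groth := gdiff 0 0.
Definition gone : groth := gdiff 1 0.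
Definition gopp (u : groth) : groth := gdiff (repr u).2 (repr u).1.
Definition gadd (u v : groth) : groth :=
  gdiff ((repr u).1 + (repr v).1) ((repr u).2 + (repr v).2).
Definition gmul (u v : groth) : groth :=
  gdiff ((repr u).1 * (repr v).1 + (repr u).2 * (repr v).2)
        ((repr u).1 * (repr v).2 + (repr u).2 * (repr v).1).

Lemma goppE a b : gopp (gdiff a b) = gdiff b a.
Proof.
have /gdiffP[k e] := gdiffE (gdiff a b).
by apply/gdiffP; exists k; rewrite [_ + a]addrC e [_ + b]addrC.
Qed.

Lemma gaddE a b c d : gadd (gdiff a b) (gdiff c d) = gdiff (a + c) (b + d).
Proof.
have /gdiffP[k e] := gdiffE (gdiff a b).
have /gdiffP[l f] := gdiffE (gdiff c d).
apply/esym/gdiffP.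
move: (repr (gdiff a b)) (repr (gdiff c d)) e f => [u v] [w t] /= e f.
exists (k + l); transitivity ((a + v + k) + (c + t + l)); first by ring.
by rewrite e f; ring.
Qed.

Lemma gmulE a b c d :
  gmul (gdiff a b) (gdiff c d) = gdiff (a * c + b * d) (a * d + b * c).
Proof.
have /gdiffP[k e] := gdiffE (gdiff a b).
have /gdiffP[l f] := gdiffE (gdiff c d).
apply/esym; transitivity (gdiff ((repr (gdiff a b)).1 * c +
  (repr (gdiff a b)).2 * d) ((repr (gdiff a b)).1 * d +
  (repr (gdiff a b)).2 * c)).
  apply/gdiffP; move: (repr _) e => [u v] /= e; exists (k * (c + d)).
  transitivity ((a + v + k) * c + (u + b + k) * d); first by ring.
  transitivity ((u + b + k) * c + (a + v + k) * d); first by rewrite e.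
  by ring.
rewrite /gmul; apply/gdiffP.
move: (repr (gdiff a b)) (repr (gdiff c d)) f => [u v] [w t] /= f.
exists (l * (u + v)).
transitivity (u * (c + t + l) + v * (w + d + l)); first by ring.
transitivity (u * (w + d + l) + v * (c + t + l)); first by rewrite f.
by ring.
Qed.

Lemma gaddA : associative gadd.
Proof.
move=> u v w; rewrite [u]gdiffE [v]gdiffE [w]gdiffE !gaddE.
by congr gdiff; ring.
Qed.

Lemma gaddC : commutative gadd.
Proof.
by move=> u v; rewrite [u]gdiffE [v]gdiffE !gaddE; congr gdiff; ring.
Qed.

Lemma gadd0 : left_id gzero gadd.
Proof. by move=> u; rewrite [u]gdiffE gaddE !add0r. Qed.

Lemma gaddN : left_inverse gzero gopp gadd.
Proof.
move=> u; rewrite [u]gdiffE goppE gaddE; apply/gdiffP.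
by exists 0; ring.
Qed.

HB.instance Definition _ :=
  GRing.isZmodule.Build groth gaddA gaddC gadd0 gaddN.

Lemma gmulA : associative gmul.
Proof.
move=> u v w; rewrite [u]gdiffE [v]gdiffE [w]gdiffE !gmulE.
by congr gdiff; ring.
Qed.

Lemma gmulC : commutative gmul.
Proof.
by move=> u v; rewrite [u]gdiffE [v]gdiffE !gmulE; congr gdiff; ring.
Qed.

Lemma gmul1 : left_id gone gmul.
Proof. by move=> u; rewrite [u]gdiffE gmulE; congr gdiff; ring. Qed.

Lemma gmulDl : left_distributive gmul gadd.
Proof.
move=> u v w; rewrite [u]gdiffE [v]gdiffE [w]gdiffE !(gmulE, gaddE).
by congr gdiff; ring.
Qed.

HB.instance Definition _ :=
  GRing.Zmodule_isComPzRing.Build groth gmulA gmulC gmul1 gmulDl.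

Definition to_groth a : groth := gdiff a 0.

Lemma to_groth_nmod : nmod_morphism to_groth.
Proof.
by split=> // a b; rewrite /to_groth [RHS]gaddE addr0.
Qed.

Lemma to_groth_monoid : monoid_morphism to_groth.
Proof.
split=> // a b; rewrite /to_groth [RHS]gmulE; congr gdiff; ring.
Qed.

HB.instance Definition _ :=
  GRing.isNmodMorphism.Build S groth to_groth to_groth_nmod.
HB.instance Definition _ :=
  GRing.isMonoidMorphism.Build S groth to_groth to_groth_monoid.

Lemma gdiff_sub a b : gdiff a b = to_groth a - to_groth b.
Proof.
rewrite /to_groth; have -> : - gdiff b 0 = gdiff 0 b by apply: goppE.
by rewrite [RHS]gaddE addr0 add0r.
Qed.

Section Lift.
Variables (K : comPzRingType) (f : {rmorphism S -> K}).

Definition groth_lift (u : groth) : K := f (repr u).1 - f (repr u).2.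

Lemma groth_liftE a b : groth_lift (gdiff a b) = f a - f b.
Proof.
have /gdiffP[k e] := gdiffE (gdiff a b).
rewrite /groth_lift; move: (repr _) e => [u v] /= e.
apply/eqP; rewrite subr_eq addrAC eq_sym subr_eq -!rmorphD; apply/eqP.
by apply: (@addIr _ (f k)); rewrite -!rmorphD e.
Qed.

Lemma groth_lift_nmod : nmod_morphism groth_lift.
Proof.
split=> [|u v]; first by rewrite [0](_ : _ = gdiff 0 0) ?groth_liftE ?subrr.
rewrite [u]gdiffE [v]gdiffE [_ + _]gaddE !groth_liftE !rmorphD; ring.
Qed.

Lemma groth_lift_monoid : monoid_morphism groth_lift.
Proof.
split=> [|u v].
  by rewrite [1](_ : _ = gdiff 1 0) ?groth_liftE // rmorph1 rmorph0 subr0.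
rewrite [u]gdiffE [v]gdiffE [_ * _]gmulE !groth_liftE !rmorphD !rmorphM; ring.
Qed.

HB.instance Definition _ :=
  GRing.isNmodMorphism.Build groth K groth_lift groth_lift_nmod.
HB.instance Definition _ :=
  GRing.isMonoidMorphism.Build groth K groth_lift groth_lift_monoid.

Lemma groth_universal :
  exists2 g : {rmorphism groth -> K}, (forall a, g (to_groth a) = f a) &
    forall h : {rmorphism groth -> K},
      (forall a, h (to_groth a) = f a) -> h =1 g.
Proof.
exists groth_lift => [a|h he u]; first by rewrite /= groth_liftE rmorph0 subr0.
by rewrite /= [u]gdiffE gdiff_sub rmorphB !he -groth_liftE gdiff_sub.
Qed.

End Lift.
End Grothendieck.

Section DefinableIso.
Variables (R : pzRingType) (M : lmodType R^c).

Definition defiso n m (A : set 'rV[M]_n) (B : set 'rV[M]_m) : Prop :=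
  exists2 f : 'rV[M]_n -> 'rV[M]_m,
    set_bij A B f & definable [set row_mx x (f x) | x in A].

Definition prodset n m (A : set 'rV[M]_n) (B : set 'rV[M]_m) :
    set 'rV[M]_(n + m) :=
  [set z | A (lsubmx z) /\ B (rsubmx z)].

Lemma lsubE n m (z : 'rV[M]_(n + m)) : lsubmx z = colsub (lshift m) z.
Proof. by apply/rowP => i; rewrite !mxE. Qed.

Lemma rsubE n m (z : 'rV[M]_(n + m)) : rsubmx z = colsub (@rshift n m) z.
Proof. by apply/rowP => i; rewrite !mxE. Qed.

Lemma colsub_comp n m k (p : 'I_n -> 'I_m) (q : 'I_k -> 'I_n) (z : 'rV[M]_m) :
  colsub q (colsub p z) = colsub (p \o q) z.
Proof. by apply/rowP => i; rewrite !mxE. Qed.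

Lemma colsub_l n m k (q : 'I_k -> 'I_n) (x : 'rV[M]_n) (y : 'rV[M]_m) :
  colsub (lshift m \o q) (row_mx x y) = colsub q x.
Proof. by rewrite -(colsub_comp (lshift m) q) -lsubE row_mxKl. Qed.

Definition subE := (lsubE, rsubE, colsub_comp).

Lemma definable_prod n m (A : set 'rV[M]_n) (B : set 'rV[M]_m) :
  definable A -> definable B -> definable (prodset A B).
Proof.
move=> dA dB; rewrite (_ : prodset A B =
    [set z | A (colsub (lshift m) z)] `&` [set z | B (colsub (@rshift n m) z)]).
  by apply: definableI; apply: definable_sub.
by apply/seteqP; split=> z; rewrite /prodset /= !subE.
Qed.

Definition reldef n m (P : 'rV[M]_n -> 'rV[M]_m -> Prop) :=
  definable [set z : 'rV[M]_(n + m) | P (lsubmx z) (rsubmx z)].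

Lemma reldef_comp n m k (P : 'rV[M]_n -> 'rV[M]_m -> Prop)
    (p : 'I_n -> 'I_k) (q : 'I_m -> 'I_k) :
  reldef P -> definable [set z | P (colsub p z) (colsub q z)].
Proof.
move=> /(definable_comp2 p q); congr definable.
by apply/seteqP; split=> z /=; rewrite row_mxKl row_mxKr.
Qed.

Record graph n m (A : set 'rV[M]_n) (B : set 'rV[M]_m)
    (P : 'rV[M]_n -> 'rV[M]_m -> Prop) : Prop := Graph {
  graph_def : reldef P;
  graph_sub : forall x y, P x y -> A x /\ B y;
  graph_tot : forall x, A x -> exists y, P x y;
  graph_sur : forall y, B y -> exists x, P x y;
  graph_fun : forall x y y', P x y -> P x y' -> y = y';
  graph_inj : forall x x' y, P x y -> P x' y -> x = x' }.

Lemma defisoP n m (A : set 'rV[M]_n) (B : set 'rV[M]_m) :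
  defiso A B <-> exists P, graph A B P.
Proof.
split=> [[f [fAB finj fsur] df]|[P [dP sP tP uP fP iP]]].
  exists (fun x y => A x /\ y = f x); split.
  - move: df; rewrite /reldef; congr definable; apply/seteqP; split=> z /=.
      by case=> x Ax <-; rewrite row_mxKl row_mxKr.
    by case=> Az e; exists (lsubmx z); rewrite // -e hsubmxK.
  - by move=> x y [Ax ->]; split=> //; apply: fAB.
  - by move=> x Ax; exists (f x).
  - by move=> y /fsur[x Ax <-]; exists x.
  - by move=> x y y' [_ ->] [_ ->].
  - by move=> x x' y [Ax ->] [Ax'] /finj; apply; rewrite inE.
pose f x := xget 0 [set y | P x y].
have Pf x : A x -> P x (f x) by move=> /tP; apply: xgetPex.
exists f.
  split=> [x /Pf/sP[]//|x x'|y /uP[x Pxy]].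
    by rewrite !inE => /Pf Px /Pf Px' e; apply: iP Px _; rewrite e.
  have [Ax By] := sP _ _ Pxy.
  by exists x => //; apply: fP Pxy; apply: Pf.
move: dP; rewrite /reldef; congr definable; apply/seteqP; split=> z /=.
  move=> Pz; have [Az _] := sP _ _ Pz; exists (lsubmx z) => //.
  by rewrite (fP _ _ _ (Pf _ Az) Pz) hsubmxK.
by case=> x Ax <-; rewrite row_mxKl row_mxKr; apply: Pf.
Qed.

Lemma defiso_sub n m (p : 'I_m -> 'I_n) (A : set 'rV[M]_n) (B : set 'rV[M]_m) :
  definable A -> set_bij A B (colsub p) -> defiso A B.
Proof.
move=> dA bij; exists (colsub p) => //.
rewrite (_ : [set _ | _ in A] = [set z | A (colsub (lshift m) z)] `&`
  [set z | colsub (@rshift n m) z = colsub (lshift m \o p) z]).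
  apply: definableI; first exact: definable_sub.
  exact: definable_eqs.
apply/seteqP; split=> z /=.
  case=> x Ax <-; rewrite -(colsub_comp (lshift m) p) -lsubE -rsubE.
  by rewrite row_mxKl row_mxKr.
rewrite -(colsub_comp (lshift m) p) -lsubE -rsubE => -[Az e].
by exists (lsubmx z); rewrite // -e hsubmxK.
Qed.

Lemma defiso_refl n (A : set 'rV[M]_n) : definable A -> defiso A A.
Proof.
move=> dA; apply: (@defiso_sub _ _ id) => //.
have e x : colsub id x = x :> 'rV[M]_n by apply/rowP => i; rewrite mxE.
split=> [x|x y _ _|x Ax]; rewrite ?e //.
by exists x; rewrite ?e.
Qed.

Lemma defiso_sym n m (A : set 'rV[M]_n) (B : set 'rV[M]_m) :
  defiso A B -> defiso B A.
Proof.
move=> /defisoP[P [dP sP tP uP fP iP]]; apply/defisoP.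
exists (fun y x => P x y); split=> //.
- have := reldef_comp (@rshift m n) (lshift n) dP; rewrite /reldef.
  by congr definable; apply/seteqP; split=> z /=; rewrite !subE.
- by move=> y x /sP[].
- by move=> y x x'; apply: iP.
by move=> y y' x; apply: fP.
Qed.

Lemma defiso_trans n m k (A : set 'rV[M]_n) (B : set 'rV[M]_m)
    (C : set 'rV[M]_k) :
  defiso A B -> defiso B C -> defiso A C.
Proof.
move=> /defisoP[P [dP sP tP uP fP iP]] /defisoP[Q [dQ sQ tQ uQ fQ iQ]].
apply/defisoP; exists (fun x z => exists y, P x y /\ Q y z); split.
- pose r : 'I_m -> 'I_((n + k) + m) := @rshift (n + k) m.
  pose l1 : 'I_n -> 'I_((n + k) + m) := lshift m \o lshift k.
  pose l2 : 'I_k -> 'I_((n + k) + m) := lshift m \o @rshift n k.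
  have := definableI (reldef_comp l1 r dP) (reldef_comp r l2 dQ).
  move=> /definable_ex; rewrite /reldef; congr definable.
  apply/seteqP; split=> z /= -[y] h; exists y; move: h;
    by rewrite /l1 /l2 !colsub_l -!lsubE -!rsubE row_mxKr.
- by move=> x z [y [/sP[Ax _] /sQ[_ Cz]]].
- by move=> x /tP[y Pxy]; have [_ /tQ[z Qyz]] := sP _ _ Pxy; exists z, y.
- by move=> z /uQ[y Qyz]; have [/uP[x Pxy] _] := sQ _ _ Qyz; exists x, y.
- move=> x z z' [y [Pxy Qyz]] [y' [Pxy' Qyz']].
  by move: Qyz'; rewrite -(fP _ _ _ Pxy Pxy') => /(fQ _ _ _ Qyz).
move=> x x' z [y [Pxy Qyz]] [y' [Pxy' Qyz']].
by move: Pxy'; rewrite -(iQ _ _ _ Qyz Qyz') => /(iP _ _ _ Pxy).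
Qed.

Lemma defiso_glue n m (A A' : set 'rV[M]_n) (B B' : set 'rV[M]_m) :
    A `&` A' = set0 -> B `&` B' = set0 ->
  defiso A B -> defiso A' B' -> defiso (A `|` A') (B `|` B').
Proof.
move=> dA dB /defisoP[P [dP sP tP uP fP iP]] /defisoP[Q [dQ sQ tQ uQ fQ iQ]].
have nA x : A x -> A' x -> False.
  by move=> Ax Ax'; have : (A `&` A') x by []; rewrite dA.
have nB y : B y -> B' y -> False.
  by move=> By By'; have : (B `&` B') y by []; rewrite dB.
apply/defisoP; exists (fun x y => P x y \/ Q x y); split.
- by have := definableU dP dQ.
- by move=> x y [/sP[]|/sQ[]]; split; [left|left|right|right].
- by move=> x [/tP|/tQ] [y h]; exists y; [left|right].
- by move=> x [/uP|/uQ] [y h]; exists y; [left|right].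
- move=> x y y' [h|h] [h'|h'].
  + exact: fP h h'.
  + by have [Ax _] := sP _ _ h; have [/(nA _ Ax)] := sQ _ _ h'.
  + by have [Ax _] := sP _ _ h'; have [/(nA _ Ax)] := sQ _ _ h.
  + exact: fQ h h'.
move=> x x' y [h|h] [h'|h'].
+ exact: iP h h'.
+ by have [_ By] := sP _ _ h; have [_ /(nB _ By)] := sQ _ _ h'.
+ by have [_ By] := sP _ _ h'; have [_ /(nB _ By)] := sQ _ _ h.
+ exact: iQ h h'.
Qed.

Lemma defiso_split n m (A A' : set 'rV[M]_n) (B : set 'rV[M]_m) :
    definable A -> definable A' -> A `&` A' = set0 ->
    defiso (A `|` A') B ->
  exists C C' : set 'rV[M]_m,
    [/\ definable C /\ definable C', C `&` C' = set0, C `|` C' = B,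
        defiso A C & defiso A' C'].
Proof.
move=> dA dA' dis /defisoP[P [dP sP tP uP fP iP]].
pose im (D : set 'rV[M]_n) : set 'rV[M]_m := [set y | exists x, D x /\ P x y].
have dim D : definable D -> definable (im D).
  move=> dD.
  have := definableI (definable_sub (@rshift m n) dD)
    (reldef_comp (@rshift m n) (lshift n) dP).
  move=> /definable_ex; congr definable; apply/seteqP.
  by split=> z /= -[y] h; exists y; move: h;
    rewrite -!lsubE -!rsubE row_mxKl row_mxKr.
have iso D : definable D -> D `<=` A `|` A' -> defiso D (im D).
  move=> dD sD; apply/defisoP; exists (fun x y => D x /\ P x y); split.
  - have := definableI (definable_sub (lshift m) dD)
      (reldef_comp (lshift m) (@rshift n m) dP).
    by congr definable; apply/seteqP; split=> z /=; rewrite !subE.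
  - by move=> x y [Dx Pxy]; split=> //; exists x.
  - by move=> x Dx; have [y Pxy] := tP _ (sD _ Dx); exists y.
  - by [].
  - by move=> x y y' [_ h] [_]; apply: fP h.
  by move=> x x' y [_ h] [_]; apply: iP h.
exists (im A), (im A'); split; first by split; apply: dim.
- rewrite -subset0 => y [[x [Ax Pxy]] [x' [Ax' Pxy']]].
  move: Ax'; rewrite -(iP _ _ _ Pxy Pxy') => Ax'.
  by have : (A `&` A') x by []; rewrite dis.
- apply/seteqP; split=> y; first by case=> -[x [_ /sP[]]].
  move=> /uP[x Pxy]; have [[Ax|Ax] _] := sP _ _ Pxy; [left|right]; by exists x.
- by apply: iso => // x Ax; left.
by apply: iso => // x Ax; right.
Qed.

Lemma defiso_prod n m n' m' (A : set 'rV[M]_n) (B : set 'rV[M]_m)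
    (A' : set 'rV[M]_n') (B' : set 'rV[M]_m') :
  defiso A A' -> defiso B B' -> defiso (prodset A B) (prodset A' B').
Proof.
move=> /defisoP[P [dP sP tP uP fP iP]] /defisoP[Q [dQ sQ tQ uQ fQ iQ]].
apply/defisoP.
exists (fun z w => P (lsubmx z) (lsubmx w) /\ Q (rsubmx z) (rsubmx w)); split.
- have := definableI
    (reldef_comp (lshift (n' + m') \o lshift m)
                 (@rshift (n + m) (n' + m') \o lshift m') dP)
    (reldef_comp (lshift (n' + m') \o @rshift n m)
                 (@rshift (n + m) (n' + m') \o @rshift n' m') dQ).
  by congr definable; apply/seteqP; split=> z /=; rewrite !subE.
- by move=> z w [/sP[? ?] /sQ[? ?]].
- move=> z [/tP[x Px] /tQ[y Qy]]; exists (row_mx x y).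
  by rewrite row_mxKl row_mxKr.
- move=> z [/uP[x Px] /uQ[y Qy]]; exists (row_mx x y).
  by rewrite row_mxKl row_mxKr.
- move=> z w w' [Pz Qz] [Pz' Qz']; rewrite -[w]hsubmxK -[w']hsubmxK.
  by rewrite (fP _ _ _ Pz Pz') (fQ _ _ _ Qz Qz').
move=> z z' w [Pz Qz] [Pz' Qz']; rewrite -[z]hsubmxK -[z']hsubmxK.
by rewrite (iP _ _ _ Pz Pz') (iQ _ _ _ Qz Qz').
Qed.

Lemma defiso_prodC n m (A : set 'rV[M]_n) (B : set 'rV[M]_m) :
  definable A -> definable B -> defiso (prodset A B) (prodset B A).
Proof.
move=> dA dB.
pose p i := match fintype.split i with
  inl j => @rshift n m j | inr j => lshift m j end.
have pE (x : 'rV[M]_n) y : colsub p (row_mx x y) = row_mx y x.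
  apply/rowP => i; rewrite [LHS]mxE [RHS]mxE /p; case: (splitP i) => j _.
    by rewrite row_mxEr.
  by rewrite row_mxEl.
apply: (@defiso_sub _ _ p); first exact: definable_prod.
split=> [z|z w _ _|z].
- by rewrite -[z]hsubmxK /prodset /= pE !row_mxKl !row_mxKr => -[].
- by rewrite -[z]hsubmxK -[w]hsubmxK !pE => /eq_row_mx[-> ->].
rewrite -[z]hsubmxK /prodset /= !row_mxKl !row_mxKr => -[Bz Az].
 exists (row_mx (rsubmx z) (lsubmx z)); last by rewrite pE.
by rewrite /= !row_mxKl !row_mxKr.
Qed.

Lemma defiso_prodA n m k (A : set 'rV[M]_n) (B : set 'rV[M]_m)
    (C : set 'rV[M]_k) :
  definable A -> definable B -> definable C ->
  defiso (prodset A (prodset B C)) (prodset (prodset A B) C).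
Proof.
move=> dA dB dC.
pose p (i : 'I_(n + m + k)) : 'I_(n + (m + k)) :=
  cast_ord (esym (addnA n m k)) i.
have pE x y z : colsub p (row_mx x (row_mx y z)) =
    row_mx (row_mx x y) z :> 'rV[M]_(n + m + k).
  rewrite row_mxA; apply/rowP => i; rewrite mxE castmxE /= esymK.
  by congr (row_mx _ _ _ _); [apply: val_inj|rewrite /p; apply: val_inj].
apply: (@defiso_sub _ _ p); first by do 2?apply: definable_prod.
split=> [z|z w _ _|z].
- rewrite -[z]hsubmxK -[rsubmx z]hsubmxK /prodset /= pE.
  by rewrite !(row_mxKl, row_mxKr) => -[? []].
- rewrite -[z]hsubmxK -[rsubmx z]hsubmxK -[w]hsubmxK -[rsubmx w]hsubmxK !pE.
  by move=> /eq_row_mx[/eq_row_mx[-> ->] ->].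
rewrite -[z]hsubmxK -[lsubmx z]hsubmxK /prodset /= !(row_mxKl, row_mxKr).
move=> [[Az Bz] Cz].
exists (row_mx (lsubmx (lsubmx z)) (row_mx (rsubmx (lsubmx z)) (rsubmx z))).
  by rewrite /= !(row_mxKl, row_mxKr).
by rewrite pE.
Qed.

Lemma defiso_pt_prod n m (a : 'rV[M]_n) (A : set 'rV[M]_m) :
  definable A -> defiso (prodset [set a] A) A.
Proof.
move=> dA; apply: (@defiso_sub _ _ (@rshift n m)).
  by apply: definable_prod => //; apply: definable_pt.
split=> [z [_]|z w|z Az]; rewrite -?rsubE //.
  rewrite !inE => -[/= za _] [/= wa _].
  by rewrite -[z]hsubmxK -[w]hsubmxK za wa !row_mxKr => ->.
exists (row_mx a z); last by rewrite -rsubE row_mxKr.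
by rewrite /prodset /= row_mxKl row_mxKr.
Qed.

Lemma defiso_set0 n m : defiso (set0 : set 'rV[M]_n) (set0 : set 'rV[M]_m).
Proof.
apply/defisoP; exists (fun _ _ => False); split=> //.
exact: definable0.
Qed.

Lemma defiso_pt n m (a : 'rV[M]_n) (b : 'rV[M]_m) : defiso [set a] [set b].
Proof.
apply/defisoP; exists (fun x y => x = a /\ y = b); split=> //.
- by apply: (@definable_prod _ _ [set a] [set b]); apply: definable_pt.
- by move=> x ->; exists b.
- by move=> x ->; exists a.
- by move=> x y y' [_ ->] [_ ->].
by move=> x y y' [-> _] [-> _].
Qed.

End DefinableIso.

Section DefinableClasses.
Variables (R : pzRingType) (M : lmodType R^c).

Record defset n := DefSet {
  defset_set :> set 'rV[M]_n;
  defsetP : definable defset_set }.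

HB.instance Definition _ n := gen_eqMixin (defset n).
HB.instance Definition _ n := gen_choiceMixin (defset n).

Definition defset0 n : defset n := DefSet (@definable0 R M n).
Definition defset1 n (a : 'rV[M]_n) : defset n := DefSet (definable_pt a).
Definition defsetU n (A B : defset n) : defset n :=
  DefSet (definableU (defsetP A) (defsetP B)).
Definition defsetX n m (A : defset n) (B : defset m) : defset (n + m) :=
  DefSet (definable_prod (defsetP A) (defsetP B)).

(* The definable subsets of M^n for all n >= 1; [A : anydefset] has dimension
   [(tag A).+1]. *)
Definition anydefset := {n : nat & defset n.+1}.

Definition anydefset_iso (A B : anydefset) : bool :=
  `[< defiso (tagged A) (tagged B) >].

Lemma anydefset_iso_refl : reflexive anydefset_iso.
Proof. by move=> A; apply/asboolP/defiso_refl/defsetP. Qed.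

Lemma anydefset_iso_sym : symmetric anydefset_iso.
Proof. by move=> A B; apply/asboolP/asboolP; apply: defiso_sym. Qed.

Lemma anydefset_iso_trans : transitive anydefset_iso.
Proof.
by move=> B A C /asboolP AB /asboolP BC; apply/asboolP/(defiso_trans AB BC).
Qed.

Canonical anydefset_iso_equiv := EquivRel anydefset_iso
  anydefset_iso_refl anydefset_iso_sym anydefset_iso_trans.

Definition defclass := {eq_quot anydefset_iso}.
HB.instance Definition _ : EqQuotient _ anydefset_iso defclass :=
  EqQuotient.on defclass.
HB.instance Definition _ := Choice.on defclass.

Definition class_of n (A : defset n.+1) : defclass :=
  \pi_defclass (Tagged (fun n => defset n.+1) A).

Lemma class_ofP n m (A : defset n.+1) (B : defset m.+1) :
  class_of A = class_of B <-> defiso A B.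
Proof. by split=> [/eqmodP/asboolP|h]; last by apply/eqmodP/asboolP. Qed.

Lemma class_of_surj (a : defclass) : exists n (A : defset n.+1), a = class_of A.
Proof.
case: (repr a) (reprK a) => n A e; exists n, A.
by rewrite -e.
Qed.

Definition class0 : defclass := class_of (defset0 1).
Definition class1 : defclass := class_of (defset1 (0 : 'rV[M]_1)).

(* [A] + [B] is the class of a disjoint union of representatives.  These exist
   as soon as M is nonzero; the default value is reached only when M = 0 and
   a = b = 1, in which case classes form the Boolean semiring. *)
Definition class_add (a b : defclass) : defclass :=
  xget class1 [set c | exists n (A B : defset n.+1),
    [/\ a = class_of A, b = class_of B, A `&` B = set0
      & c = class_of (defsetU A B)]].

Definition class_mul (a b : defclass) : defclass :=
  class_of (defsetX (tagged (repr a)) (tagged (repr b))).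

Lemma class_addE n (A B : defset n.+1) : A `&` B = set0 ->
  class_add (class_of A) (class_of B) = class_of (defsetU A B).
Proof.
move=> dAB; rewrite /class_add; set P := (X in xget _ X).
have : P (xget class1 P).
  by apply: xgetPex; exists (class_of (defsetU A B)), n, A, B.
case=> m [A' [B' [/class_ofP AA' /class_ofP BB' dAB' ->]]].
by apply/class_ofP; apply: defiso_glue => //; apply: defiso_sym.
Qed.

Lemma class_mulE n m (A : defset n.+1) (B : defset m.+1) :
  class_mul (class_of A) (class_of B) = class_of (defsetX A B).
Proof.
have e k (C : defset k.+1) : defiso (tagged (repr (class_of C))) C.
  apply/class_ofP; rewrite -[RHS](reprK (class_of C)).
  by case: (repr _).
by apply/class_ofP; exact: (defiso_prod (e _ _) (e _ _)).
Qed.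

Lemma class_of_set0 n (A : defset n.+1) :
  A = set0 :> set _ -> class_of A = class0.
Proof. by move=> A0; apply/class_ofP; rewrite A0; apply: defiso_set0. Qed.

Lemma class_addC : commutative class_add.
Proof.
move=> a b; congr xget; apply/seteqP.
by split=> c [n [A [B [-> -> d ->]]]]; exists n, B, A; split=> //;
  rewrite 1?setIC //; apply/class_ofP; rewrite /= setUC;
  apply: defiso_refl; apply: (defsetP (defsetU B A)).
Qed.

Lemma class_add0 : left_id class0 class_add.
Proof.
move=> a; have [n [A ->]] := class_of_surj a.
rewrite -(@class_of_set0 n (defset0 _)) // class_addE ?set0I //.
by apply/class_ofP; rewrite /= set0U; apply/defiso_refl/defsetP.
Qed.

Lemma class_mulC : commutative class_mul.
Proof.
move=> a b; have [n [A ->]] := class_of_surj a.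
have [m [B ->]] := class_of_surj b.
by rewrite !class_mulE; apply/class_ofP;
  exact: (defiso_prodC (defsetP A) (defsetP B)).
Qed.

Lemma class_mulA : associative class_mul.
Proof.
move=> a b c; have [n [A ->]] := class_of_surj a.
have [m [B ->]] := class_of_surj b; have [k [C ->]] := class_of_surj c.
rewrite !(class_mulE, @class_mulE _ (m + k.+1)%N, @class_mulE (n + m.+1)%N).
by apply/class_ofP; exact: (defiso_prodA (defsetP A) (defsetP B) (defsetP C)).
Qed.

Lemma class_mul1 : left_id class1 class_mul.
Proof.
move=> a; have [n [A ->]] := class_of_surj a.
rewrite class_mulE; apply/class_ofP.
change (defiso (prodset [set (0 : 'rV[M]_1)] A) A).
exact: defiso_pt_prod (defsetP A).
Qed.

Lemma class_mul0 : left_zero class0 class_mul.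
Proof.
move=> a; have [n [A ->]] := class_of_surj a.
rewrite class_mulE; apply: class_of_set0.
by rewrite -subset0 => z [].
Qed.

Lemma class_disjoint (a b : defclass) : (exists c : M, c != 0) ->
  exists n (A B : defset n.+1),
    [/\ a = class_of A, b = class_of B & A `&` B = set0].
Proof.
case=> c c0; have [n [A ->]] := class_of_surj a.
have [m [B ->]] := class_of_surj b.
pose pt k (d : M) : defset k := defset1 (const_mx d).
exists (n + (m.+1 + 1))%N.
exists (defsetX A (defsetX (pt m.+1 0) (pt 1%N 0))).
exists (defsetX (pt n.+1 0) (defsetX B (pt 1%N c))); split.
- apply/class_ofP; apply: defiso_sym.
  have h1 := defiso_prodC (defsetP A)
    (defsetP (defsetX (pt m.+1 0) (pt 1%N 0))).
  have h2 : defiso (defsetX (pt m.+1 0) (pt 1%N 0)) [set (0 : 'rV[M]_1)].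
    exact: (defiso_trans (defiso_pt_prod _ (definable_pt _)) (defiso_pt _ _)).
  have h3 := defiso_prod h2 (defiso_refl (defsetP A)).
  have h4 := defiso_pt_prod (0 : 'rV[M]_1) (defsetP A).
  exact: (defiso_trans h1 (defiso_trans h3 h4)).
- apply/class_ofP; apply: defiso_sym.
  have h1 := defiso_pt_prod (const_mx 0 : 'rV_n.+1)
    (defsetP (defsetX B (pt 1%N c))).
  have h2 := defiso_prodC (defsetP B) (defsetP (pt 1%N c)).
  have h3 := defiso_pt_prod (const_mx c : 'rV_1) (defsetP B).
  exact: (defiso_trans h1 (defiso_trans h2 h3)).
rewrite -subset0 => z [[_ [_ /= e]] [_ [_ /=]]].
by rewrite e => /rowP/(_ 0); rewrite !mxE => /esym/eqP; apply/negP.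
Qed.

Lemma class_trivial : ~ (exists c : M, c != 0) ->
  (forall a, a = class0 \/ a = class1) /\ class_add class1 class1 = class1.
Proof.
move=> h.
have M0 (c : M) : c = 0 by apply/eqP/negPn/negP => c0; apply: h; exists c.
have V0 n (x : 'rV[M]_n) : x = 0 by apply/rowP => i; rewrite !mxE.
split=> [a|].
  have [n [A ->]] := class_of_surj a.
  have [/class_of_set0 ->|/set0P[x Ax]] := eqVneq (A : set _) set0.
    by left.
  right; apply/class_ofP => /=.
  rewrite (_ : defset_set A = [set 0]); first exact: defiso_pt.
  apply/seteqP; split=> y /=; first by rewrite (V0 _ y).
  by rewrite (V0 _ x) in Ax => ->.
apply: xgetPN => c [n [A [B [/class_ofP iA /class_ofP iB d _]]]].
have A0 : (A : set _) 0.
  by case: iA => f [fA _ _] _; rewrite -(V0 _ (f 0)); apply: fA.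
have B0 : (B : set _) 0.
  by case: iB => f [fA _ _] _; rewrite -(V0 _ (f 0)); apply: fA.
by have : (A `&` B) 0 by []; rewrite d.
Qed.

Lemma class_addA : associative class_add.
Proof.
move=> a b c; have [M1|/class_trivial[M0 e]] := pselect (exists c : M, c != 0).
  have [n [B [C [-> -> dBC]]]] := class_disjoint b c M1; rewrite class_addE //.
  have [m [A' [E [-> /class_ofP eE dAE]]]] :=
    class_disjoint a (class_of (defsetU B C)) M1.
  have [B' [C' [[dB' dC'] dBC' EU iB iC]]] :=
    defiso_split (defsetP B) (defsetP C) dBC eE.
  have -> : class_of B = class_of (DefSet dB') by apply/class_ofP.
  have -> : class_of C = class_of (DefSet dC') by apply/class_ofP.
  have -> : class_of (defsetU B C) = class_of E by apply/class_ofP.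
  move: dAE; rewrite -EU setIUr setU_eq0 => -[d1 d2].
  have d3 : A' `&` E = set0 by rewrite -EU setIUr d1 d2 setU0.
  have d4 : (A' `|` B') `&` C' = set0 by rewrite setIUl d2 dBC' setU0.
  rewrite (class_addE d3) (@class_addE _ A' (DefSet dB') d1).
  rewrite (@class_addE _ (defsetU A' (DefSet dB')) (DefSet dC') d4).
  by apply/class_ofP; rewrite /= -EU setUA; apply/defiso_refl;
    rewrite -setUA EU; apply: (defsetP (defsetU A' E)).
by case: (M0 a) => ->; case: (M0 b) => ->; case: (M0 c) => ->;
  rewrite ?e ?(class_add0, class_addC _ class0) ?e.
Qed.

Lemma class_mulDl : left_distributive class_mul class_add.
Proof.
move=> a b c; have [M1|/class_trivial[M0 e]] := pselect (exists c : M, c != 0).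
  have [n [A [B [-> -> dAB]]]] := class_disjoint a b M1.
  have [m [C ->]] := class_of_surj c.
  have d : prodset A C `&` prodset B C = set0.
    rewrite -subset0 => z [[Az _] [Bz _]].
    by have : (A `&` B) (lsubmx z) by []; rewrite dAB.
  have ABC : prodset (A `|` B) C = prodset A C `|` prodset B C.
    apply/seteqP; split=> z; first by case=> -[]; [left|right].
    by case=> -[? ?]; split=> //; [left|right].
  rewrite class_addE // !class_mulE.
  rewrite (@class_addE (n + m.+1)%N (defsetX A C) (defsetX B C) d).
  apply/class_ofP.
  change (defiso (prodset (A `|` B) C) (prodset A C `|` prodset B C)).
  rewrite ABC; apply: defiso_refl.
  exact: definableU (defsetP (defsetX A C)) (defsetP (defsetX B C)).
by case: (M0 a) => ->; case: (M0 b) => ->; case: (M0 c) => ->;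
  rewrite ?e ?(class_add0, class_mul0, class_mul1, class_addC _ class0) ?e
    ?class_mul1.
Qed.

HB.instance Definition _ :=
  GRing.isNmodule.Build defclass class_addA class_addC class_add0.
HB.instance Definition _ := GRing.Nmodule_isComPzSemiRing.Build defclass
  class_mulA class_mulC class_mul1 class_mulDl class_mul0.

Definition K0 := groth defclass.
HB.instance Definition _ := GRing.ComPzRing.on K0.

Definition K0_class n (A : defset n.+1) : K0 := to_groth (class_of A).

End DefinableClasses.

(* Main.v *)
(* By Baur-Monk elimination of quantifiers, every definable set is a finite
   Boolean combination of cosets of pp-definable subgroups (pp-cosets).  When
   M is elementarily equivalent to M^(aleph_0), a pp-subgroup of M that is not
   contained in another one has infinite index over their intersection, so by
   B.H. Neumann's lemma the indicator functions of pp-cosets of M^n are linearly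
   independent.  Hence the indicator function of a definable set A of M is a
   unique combination of those of pp-cosets C_j, with integer coefficients a_j,
   and A is sent to sum_j a_j [P_j `&` N^n], where P_j is the subgroup parallel
   to C_j.  If A and B are definably isomorphic, the blocks of the graph come
   from pp-cosets that (again by Neumann's lemma) project injectively on both
   sides, and by purity so do the traces on N of their subgroups; this gives
   the invariance.  Surjectivity follows from elimination of quantifiers in N,
   whose pp-subgroups are traces of those of M. *)

Require Import Defs.
From HB Require Import structures.
From mathcomp Require Import all_boot all_algebra.
From mathcomp Require Import boolp classical_sets functions cardinality.

Set Implicit Arguments.
Unset Strict Implicit.
Unset Printing Implicit Defensive.

Import GRing.Theory.

Local Open Scope ring_scope.
Local Open Scope classical_set_scope.

(** * Finite unions of cosets *)

Section Cosets.
Variable V : zmodType.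
Implicit Types (G H K C D : set V) (x y : V).

Definition subgroup G := G 0 /\ forall x y, G x -> G y -> G (x - y).

(* The empty set counts as a coset of every subgroup. *)
Definition coset_of G D := forall x, D x -> forall y, D y <-> G (y - x).

(** For subgroups this says that [H] meets only finitely many cosets of [G], that is, the index of
    their intersection in [H] is finite; neither [G] nor the representatives have to lie in [H]. *)
Definition finindex H G :=
  exists cs : seq V, forall h, H h -> exists2 c, c \in cs & G (h - c).

Lemma subgroupN G x : subgroup G -> G x -> G (- x).
Proof. by case=> G0 GB Gx; rewrite -sub0r; apply: GB. Qed.

Lemma subgroupD G x y : subgroup G -> G x -> G y -> G (x + y).
Proof.
by move=> sG Gx Gy; rewrite -[y]opprK; apply: (proj2 sG) => //; apply: subgroupN.
Qed.

Lemma subgroup_sym G x y : subgroup G -> G (x - y) -> G (y - x).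
Proof. by move=> sG /(subgroupN sG); rewrite opprB. Qed.

Lemma subgroup_trans G y x z :
  subgroup G -> G (x - y) -> G (y - z) -> G (x - z).
Proof. by move=> sG h1 h2; have := subgroupD sG h1 h2; rewrite addrA subrK. Qed.

Lemma coset_of_eq G C x : coset_of G C -> C x -> C = [set y | G (y - x)].
Proof. by move=> GC Cx; apply/seteqP; split=> y /(GC x Cx). Qed.

Lemma coset_of_translate G x : subgroup G -> coset_of G [set y | G (y - x)].
Proof.
move=> sG y Gy z; split=> /= Gz.
  by apply: (subgroup_trans sG Gz); apply: subgroup_sym.
exact: (subgroup_trans sG Gz).
Qed.

(** A coset of [G] and a coset of [K] that meet do so in a coset of the intersection. A common point
    is chosen for each pair; pairs that do not meet contribute the harmless default 0. *)
Lemma finindexI H G K : subgroup G -> subgroup K ->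
  finindex H G -> finindex H K -> finindex H (G `&` K).
Proof.
move=> sG sK [cs csP] [ds dsP].
exists [seq xget 0 [set x | G (x - c) /\ K (x - d)] | c <- cs, d <- ds] => h Hh.
have [c ccs Gc] := csP h Hh; have [d dds Kd] := dsP h Hh.
set r := fun c d => xget 0 [set x | G (x - c) /\ K (x - d)].
exists (r c d); first by apply/allpairsP; exists (c, d).
have [] : [set x | G (x - c) /\ K (x - d)] (r c d) by apply: xgetPex; exists h.
by move=> Gr Kr; split; [apply: (subgroup_trans sG Gc)|
  apply: (subgroup_trans sK Kd)]; apply: subgroup_sym.
Qed.

Lemma finindex_trans H K G : subgroup G ->
  finindex H K -> finindex K G -> finindex H G.
Proof.
move=> sG [cs csP] [ds dsP]; exists [seq c + d | c <- cs, d <- ds] => h Hh.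
have [c ccs Kc] := csP h Hh; have [d dds Gd] := dsP _ Kc.
by exists (c + d); [apply/allpairsP; exists (c, d)|rewrite opprD addrA].
Qed.

Lemma finindex_refl G : subgroup G -> finindex G G.
Proof.
by move=> [G0 GB]; exists [:: 0] => h Gh; exists 0; rewrite ?inE ?subr0.
Qed.

(** B.H. Neumann's lemma, by induction on the list of subgroups. One list [cs] serves all of them
    and is quantified after [gs], so that the induction hypothesis can be applied to a longer
    list. *)
Lemma neumann_subgroups K (gs : seq (set V)) : subgroup K ->
  (forall G, G \in gs -> subgroup G /\ ~ finindex K G) ->
  forall cs : seq V,
    exists2 h, K h & forall c G, c \in cs -> G \in gs -> ~ G (h - c).
Proof.
move=> sK; elim: gs => [|G gs ih] gsP cs; first by exists 0; case: sK.
have [sG iG] : subgroup G /\ ~ finindex K G by apply: gsP; rewrite mem_head.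
have {}ih := ih (fun G' G's => gsP G' (mem_behead (s := G :: gs) G's)).
(* [x + G] misses the cosets [c + G], so if [K] were covered then [x + G],
   hence every coset of [G] in [K], would be covered by cosets from [gs]. *)
have [x Kx xP] : exists2 x, K x & forall c, c \in cs -> ~ G (x - c).
  apply: contrapT => no; apply: iG; exists cs => h Kh.
  apply: contrapT => nc; apply: no; exists h => // c ccs Gc.
  by apply: nc; exists c.
(* [rep c] is a point of [K] in the coset of [c]. Translation by [x - rep c] carries this coset onto
   that of [x], and the representatives added to [cs] pull the cosets from [gs] back along these
   translations. *)
pose rep c := xget 0 [set y | K y /\ G (y - c)].
have [h Kh hP] := ih (cs ++ [seq d + rep c - x | d <- cs, c <- cs]).
apply: contrapT => no.
have [c ccs Gc] : exists2 c, c \in cs & G (h - c).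
  apply: contrapT => nc; apply: no; exists h => // c G' ccs.
  rewrite inE => /orP[/eqP->|G's] Gc; first by apply: nc; exists c.
  by apply: (hP c G') Gc; rewrite // mem_cat ccs.
have [Kr Gr] : K (rep c) /\ G (rep c - c).
  by apply: (@xgetPex _ 0 [set y | K y /\ G (y - c)]); exists h.
apply: no; exists (x + (h - rep c)).
  by apply: subgroupD => //; apply: (proj2 sK).
move=> d G' dcs; rewrite inE => /orP[/eqP-> Gd|G's].
  apply: (xP d dcs); apply: (subgroup_trans sG _ Gd).
  rewrite opprD addrA subrr sub0r; apply: subgroupN => //.
  by apply: (subgroup_trans sG Gc); apply: subgroup_sym.
have -> : x + (h - rep c) - d = h - (d + rep c - x).
  by rewrite opprB addrCA -!addrA [d + _]addrC opprD.
apply: hP => //; rewrite mem_cat; apply/orP; right.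
by apply/allpairsP; exists (d, c).
Qed.

(** Pairing every representative with every subgroup covers at least the union of [ds], so
    [neumann_subgroups] applies. The base point [x] is absorbed by shifting the representatives. *)
Lemma neumann K (ds : seq (set V)) : subgroup K ->
  (forall D, D \in ds ->
     exists G, [/\ subgroup G, ~ finindex K G & coset_of G D]) ->
  forall x, exists2 h, K h & forall D, D \in ds -> ~ D (x + h).
Proof.
move=> sK dsP x.
have [cs [gs [gsP csP]]] : exists (cs : seq V) (gs : seq (set V)),
    (forall G, G \in gs -> subgroup G /\ ~ finindex K G) /\
    forall D y, D \in ds -> D y ->
      exists c G, [/\ c \in cs, G \in gs & G (y - c)].
  elim: ds dsP => [|D ds ih] dsP; first by exists [::], [::].
  have [|cs [gs [gsP csP]]] := ih.
    by move=> D' D's; apply: dsP; rewrite inE D's orbT.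
  have [G [sG iG DG]] := dsP D (mem_head _ _).
  exists (xget 0 D :: cs), (G :: gs); split=> [G'|D' y].
    by rewrite inE => /orP[/eqP->|/gsP].
  rewrite inE => /orP[/eqP-> Dy|D's /(csP _ _ D's)[c [G' [h1 h2 h3]]]].
    exists (xget 0 D), G; rewrite !mem_head; split=> //.
    by apply/DG => //; apply: xgetPex; exists y.
  by exists c, G'; rewrite !inE h1 h2 !orbT.
have [h Kh hP] := neumann_subgroups sK gsP [seq c - x | c <- cs].
exists h => // D Ds /(csP _ _ Ds)[c [G [ccs Gs Gc]]].
by apply: (hP (c - x) G (map_f _ ccs) Gs); rewrite opprB addrCA addrA.
Qed.

(** Turns the counting of cosets of [K] in [H] into [count] over a list. The list is built greedily:
    each [c] adds a point of [H] in its coset, if there is one not yet covered. *)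
Lemma transversal H K (cs : seq V) : subgroup K ->
  exists T : seq V, [/\ uniq T, forall t, t \in T -> H t,
    {in T &, forall t t', K (t - t') -> t = t'} &
    forall h, H h -> (exists2 c, c \in cs & K (h - c)) ->
      exists2 t, t \in T & K (h - t)].
Proof.
move=> sK; elim: cs => [|c cs [T [uT TH TK Tcs]]].
  by exists [::]; split=> // h _ [].
case: (pselect (exists h, [/\ H h, K (h - c) &
                 forall t, t \in T -> ~ K (h - t)])) => [[h [Hh Kh nh]]|no].
  exists (h :: T); split=> [|t|t t'|h' Hh' [d]].
  - rewrite /= uT andbT; apply/negP => /nh; apply.
    by rewrite subrr; case: sK.
  - by rewrite inE => /orP[/eqP->|/TH].
  - rewrite !inE => /orP[/eqP->|tT] /orP[/eqP->|t'T] //; last exact: TK.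
      by move=> /(nh _ t'T).
    by move=> /(subgroup_sym sK)/(nh _ tT).
  rewrite inE => /orP[/eqP-> Kd|dcs Kd].
    exists h; rewrite ?mem_head //; apply: (subgroup_trans sK Kd).
    exact: subgroup_sym.
  by have [|t tT] := Tcs h' Hh'; [exists d|exists t; rewrite // inE tT orbT].
exists T; split=> // h Hh [d]; rewrite inE => /orP[/eqP-> Kd|dcs Kd]; last first.
  by apply: Tcs => //; exists d.
apply: contrapT => nt; apply: no; exists h; split=> // t tT Kt.
by apply: nt; exists t.
Qed.

(** Translation by [h' - h] permutes the cosets of [K] in [H] and carries the coset of [G] through
    [h] onto that through [h']; [r] is this permutation on representatives. By symmetry the two
    counts agree. *)
Lemma leq_count_translate H K G (T : seq V) h h' : subgroup H -> subgroup K ->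
    subgroup G -> K `<=` G -> uniq T -> (forall t, t \in T -> H t) ->
    {in T &, forall t t', K (t - t') -> t = t'} ->
    (forall h, H h -> exists2 t, t \in T & K (h - t)) -> H h -> H h' ->
  (count (fun t => `[< G (t - h)%R >]) T <=
   count (fun t => `[< G (t - h')%R >]) T)%N.
Proof.
move=> sH sK sG KG uT TH TK Tcov Hh Hh'.
pose r t := xget 0 [set u | u \in T /\ K (t - h + h' - u)].
have rP t : t \in T -> r t \in T /\ K (t - h + h' - r t).
  move=> /TH Ht; apply: (@xgetPex _ 0 [set u | u \in T /\ _]).
  have [|u Tu Ku] := Tcov (t - h + h'); last by exists u.
  by apply: subgroupD => //; apply: (proj2 sH).
rewrite -!size_filter -(size_map r); apply: uniq_leq_size.
  rewrite map_inj_in_uniq ?filter_uniq // => t t'.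
  rewrite !mem_filter => /andP[_ tT] /andP[_ t'T] e.
  have [_ k1] := rP _ tT; have [_ k2] := rP _ t'T; apply: TK => //.
  have := subgroup_trans sK k1; rewrite e => /(_ _ (subgroup_sym sK k2)).
  by rewrite opprD addrACA subrr addr0 opprD addrACA subrr addr0.
move=> x /mapP[t]; rewrite !mem_filter => /andP[/asboolP Gt tT] ->.
have [-> /KG/(subgroup_sym sG) Gr] := rP _ tT; rewrite andbT; apply/asboolP.
by have := subgroupD sG Gr Gt; rewrite [t - h + h']addrC opprD [r t + _]addrA subrK.
Qed.

(* Inclusion-exclusion, without the alternating sum. *)
Lemma count_none_eq (I : eqType) (a b : I -> pred V) (T T' : seq V)
    (p q : pred V) (F : seq I) :
  (forall D : seq I, {subset D <= F} ->
     count (fun t => p t && all (a^~ t) D) T =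
     count (fun t => q t && all (b^~ t) D) T') ->
  count (fun t => p t && ~~ has (a^~ t) F) T =
  count (fun t => q t && ~~ has (b^~ t) F) T'.
Proof.
elim: F p q => [|i F ih] p q h; first by have := h [::] (fun _ => id).
(* The natural subtraction is exact, because the second count is bounded by the first. *)
have split_count (c : I -> pred V) (r : pred V) (S : seq V) :
    count (fun t => r t && ~~ has (c^~ t) (i :: F)) S =
    (count (fun t => r t && ~~ has (c^~ t) F) S -
     count (fun t => (r t && c i t) && ~~ has (c^~ t) F) S)%N.
  apply/esym; elim: S => //= t S <- /=.
  have: (count (fun t => (r t && c i t) && ~~ has (c^~ t) F) S <=
         count (fun t => r t && ~~ has (c^~ t) F) S)%N.
    by apply: sub_count => u /andP[/andP[-> _] ->].
  by case: (r t); case: (c i t); case: (has _ F) => //= le;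
    rewrite ?subnDl ?add0n ?addnBA.
rewrite !split_count; congr (_ - _)%N.
  by apply: ih => D DF; apply: h => j /DF jF; rewrite inE jF orbT.
apply: ih => D DF; have /= := h (i :: D).
rewrite (eq_count (a2 := fun t => (p t && a i t) && all (a^~ t) D)) => [|t]; last first.
  by rewrite /= andbA.
rewrite [X in _ -> _ = X](eq_count (a2 := fun t => q t && (b i t && all (b^~ t) D))).
  by apply=> j; rewrite !inE => /orP[/eqP->|/DF->]; rewrite ?eqxx ?orbT.
by move=> t /=; rewrite andbA.
Qed.

End Cosets.

(** The combinatorial core of quantifier elimination: which intersections are nonempty determines
    which Boolean patterns occur. Inside the intersection of the cosets through [y], the other
    cosets of finite index are handled by counting, and those of infinite index by Neumann's
    lemma. *)
Lemma coset_pattern (V : zmodType) (I : finType) (G D D' : I -> set V) :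
    (forall i, subgroup (G i)) ->
    (forall i, coset_of (G i) (D i)) -> (forall i, coset_of (G i) (D' i)) ->
    (forall J : {set I}, (exists y, forall i, i \in J -> D i y) <->
                         (exists y, forall i, i \in J -> D' i y)) ->
  forall y, exists y', forall i, D i y <-> D' i y'.
Proof.
move=> sG DG D'G pat y.
pose J0 := [set i | `[< D i y >]]%SET.
have J0P i : i \in J0 <-> D i y by rewrite inE; split=> /asboolP.
have [y0 y0P] : exists y, forall i, i \in J0 -> D' i y.
  by apply/pat; exists y => i /J0P.
pose H := [set h | forall i, i \in J0 -> G i h].
have sH : subgroup H.
  split=> [i _|h h' Hh Hh' i iJ]; first by case: (sG i).
  by apply: (proj2 (sG i)); [apply: Hh|apply: Hh'].
(* [F] lists the cosets to be avoided whose subgroups have finite index in [H]. Such a coset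
   contains each coset of [K] that it meets, and [K] has finite index in [H]. *)
pose F := [seq i <- enum I | (i \notin J0) && `[< finindex H (G i) >]].
have FP i : i \in F <-> ~ D i y /\ finindex H (G i).
  rewrite mem_filter mem_enum andbT; split.
    by case/andP=> iJ /asboolP iG; split=> // /J0P; apply/negP.
  by case=> iJ iG; apply/andP; split; [apply/negP => /J0P|apply/asboolP].
pose K := [set h | H h /\ forall i, i \in F -> G i h].
have sK : subgroup K.
  split=> [|h h' [Hh Fh] [Hh' Fh']].
    by split; [case: sH|move=> i _; case: (sG i)].
  split; first exact: (proj2 sH).
  by move=> i iF; apply: (proj2 (sG i)); [apply: Fh|apply: Fh'].
have HK : finindex H K.
  have : forall i, i \in F -> finindex H (G i) by move=> i /FP[].
  rewrite /K; elim: (F) => [|i s ih] sP.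
    rewrite (_ : [set _ | _] = H); first exact: finindex_refl.
    by apply/seteqP; split=> h // [].
  rewrite (_ : [set _ | _] =
    G i `&` [set h | H h /\ forall i, i \in s -> G i h]).
    apply: finindexI => //; last 2 first.
    - by apply: sP; rewrite mem_head.
    - by apply: ih => j js; apply: sP; rewrite inE js orbT.
    split=> [|h h' [Hh Fh] [Hh' Fh']].
      by split; [case: sH|move=> j _; case: (sG j)].
    split; first exact: (proj2 sH).
    by move=> j js; apply: (proj2 (sG j)); [apply: Fh|apply: Fh'].
  apply/seteqP; split=> h /= [].
    move=> Hh sh; split; first by apply: sh; rewrite mem_head.
    by split=> // j js; apply: sh; rewrite inE js orbT.
  move=> Gh [Hh sh]; split=> // j; rewrite inE => /orP[/eqP->//|].
  exact: sh.
have [cs csP] := HK; have [T [uT TH TK Tcs]] := transversal H cs sK.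
have Tcov h : H h -> exists2 t, t \in T & K (h - t).
  by move=> Hh; exact: (Tcs h Hh (csP h Hh)).
pose a i : pred V := fun t => `[< D i (y + t) >].
pose b i : pred V := fun t => `[< D' i (y0 + t) >].
(* Both counts vanish when the cosets indexed by [J0] and [E] have no common point. Otherwise both
   count the cosets of [K] in the trace on [H] of a coset of [GE] through a point of [H]. By [pat]
   the same case occurs on both sides. *)
have cab (E : seq I) : {subset E <= F} ->
    count (fun t => predT t && all (a^~ t) E) T =
    count (fun t => predT t && all (b^~ t) E) T.
  move=> EF.
  pose J := (J0 :|: [set i in E])%SET.
  have JP i : i \in J <-> i \in J0 \/ i \in E.
    by rewrite finset.in_setU [X in _ || X]inE; split=> /orP.
  pose GE := [set g | forall i, i \in E -> G i g].
  have sGE : subgroup GE.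
    split=> [i _|h h' Gh Gh' i iJ]; first by case: (sG i).
    by apply: (proj2 (sG i)); [apply: Gh|apply: Gh'].
  have KGE : K `<=` GE by move=> k [_ Fk] i /EF; apply: Fk.
  have aE (B : I -> set V) x z : (forall i, coset_of (G i) (B i)) ->
      (forall i, i \in J -> B i z) ->
      (fun t => predT t && all (fun i => `[< B i (x + t) >]) E) =1
      (fun t => `[< GE (t - (z - x)) >]).
    move=> BG Bz t /=; apply/idP/asboolP.
      move=> /allP h i iE; have /asboolP := h i iE.
      rewrite (BG _ z); last by apply/Bz/JP; right.
      by rewrite opprB [x + t]addrC addrA.
    move=> GEt; apply/allP => i iE; apply/asboolP.
    rewrite (BG _ z); last by apply/Bz/JP; right.
    by move: (GEt i iE); rewrite opprB [x + t]addrC addrA.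
  have HB (B : I -> set V) x z : (forall i, coset_of (G i) (B i)) ->
      (forall i, i \in J0 -> B i x) -> (forall i, i \in J -> B i z) -> H (z - x).
    move=> BG Bx Bz i iJ; apply/(BG i x (Bx i iJ)).
    by apply/Bz/JP; left.
  have noE (B : I -> set V) x : (forall i, coset_of (G i) (B i)) ->
      (forall i, i \in J0 -> B i x) -> ~ (exists z, forall i, i \in J -> B i z) ->
      count (fun t => predT t && all (fun i => `[< B i (x + t) >]) E) T = 0%N.
    move=> BG Bx no; apply/eqP; rewrite -leqn0 leqNgt -has_count.
    apply/negP => /hasP[t /TH Ht /= /allP h]; apply: no; exists (x + t) => i.
    case/JP=> [iJ|/h/asboolP//].
    by apply/(BG i x (Bx i iJ)); rewrite addrAC subrr add0r; apply: Ht.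
  case: (pselect (exists z, forall i, i \in J -> D i z)) => [ez|no]; last first.
    rewrite /a /b noE ?noE //; first by move=> /pat.
    by move=> i /J0P.
  have [z zP] := ez; have [z' z'P] := (proj1 (pat J)) ez.
  rewrite (eq_count (aE D y z DG zP)) (eq_count (aE D' y0 z' D'G z'P)).
  have Hh : H (z - y) by apply: (HB D) => // i /J0P.
  have Hh' : H (z' - y0) by apply: (HB D').
  by apply/eqP; rewrite eqn_leq; apply/andP; split;
    apply: (@leq_count_translate _ H K GE).
(* On the side of [D] the count of cosets avoiding [F] is positive, since the representative of 0
   stands for the coset of [y] itself; hence it is positive on the side of [D']. *)
have [t' t'T t'P] : exists2 t', t' \in T & ~~ has (b^~ t') F.
  apply/hasP; rewrite has_count -(count_none_eq cab) -has_count.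
  have [|t tT Kt] := Tcov 0; first by case: sH.
  apply/hasP; exists t => //=; apply/hasPn => i iF; apply/asboolP => Dt.
  have [nD _] := (proj1 (FP i)) iF; apply: nD; apply/(DG i _ Dt).
  by rewrite opprD addrA subrr -[0 - t]/(0 - t); apply: (proj2 Kt).
(* The remaining cosets to be avoided have infinite index in [H], hence in [K], so some point of
   [y0 + t' + K] lies outside them all. *)
pose ds := [seq D' i | i <- enum I & `[< ~ D i y /\ ~ finindex H (G i) >] ].
have [|k Kk kP] := @neumann _ K ds sK _ (y0 + t'); last first.
  exists (y0 + t' + k) => i.
  case: (pselect (D i y)) => [Diy|nD].
    split=> // _; have /J0P iJ := Diy; apply/(D'G i y0 (y0P i iJ)).
    rewrite -[y0 + t' + k]addrA [y0 + _]addrC addrK.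
    by apply: subgroupD => //; [apply: (TH t')|case: Kk => Hk _; apply: Hk].
  split=> // D'i; exfalso; case: (pselect (finindex H (G i))) => [iF|iF].
    have {}iF : i \in F by apply/FP.
    have /hasPn/(_ i iF)/negP := t'P; apply; apply/asboolP.
    apply/(D'G i _ D'i); rewrite opprD addrA subrr sub0r.
    by apply: subgroupN => //; apply: (proj2 Kk).
  case: (kP (D' i)) => //; apply: map_f.
  by rewrite mem_filter mem_enum andbT; apply/asboolP.
move=> D0 /mapP[i]; rewrite mem_filter => /andP[/asboolP[nD iH] _] ->.
exists (G i); split=> // KG; apply: iH.
exact: finindex_trans KG.
Qed.

(** * pp-formulas and pp-cosets *)

Section PPFormulas.
Variable R : pzRingType.
Implicit Types M : lmodType R^c.

(** The constructions are made on formulas and not on subgroups, so that one formula can be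
    evaluated both in [M] and in [N], as purity requires. *)
Definition pp_true n : ppformula R n :=
  PPFormula (0 : 'M_(0, n)) (0 : 'M_(0, 0)).

Definition pp_lin n (r : 'I_n -> R) : ppformula R n :=
  PPFormula (\row_j r j) (0 : 'M_(1, 0)).

Definition pp_zero n : ppformula R n := PPFormula 1%:M (0 : 'M_(n, 0)).

Definition pp_and n (f g : ppformula R n) : ppformula R n :=
  PPFormula (col_mx (pp_free f) (pp_free g))
            (block_mx (pp_bound f) 0 0 (pp_bound g)).

(** Variables with the same image under [p] are identified, so their columns are added. *)
Definition pp_sub n m (p : 'I_n -> 'I_m) (f : ppformula R n) :
    ppformula R m :=
  PPFormula (\matrix_(l, i) \sum_(j | p j == i) pp_free f l j) (pp_bound f).

Definition pp_ex m n (f : ppformula R (m + n)) : ppformula R n :=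
  PPFormula (rsubmx (pp_free f)) (row_mx (lsubmx (pp_free f)) (pp_bound f)).

Definition pp_eqs n k (p q : 'I_k -> 'I_n) : ppformula R n :=
  PPFormula (\matrix_(l, i) ((i == p l)%:R - (i == q l)%:R)) (0 : 'M_(k, 0)).

Definition pp_image n m (p : 'I_n -> 'I_m) (f : ppformula R m) :
    ppformula R n :=
  pp_ex (pp_and (pp_sub (lshift n) f) (pp_eqs (lshift n \o p) (@rshift m n))).

Lemma ppset_true M n : ppset M (pp_true n) = setT.
Proof. by apply/seteqP; split=> x _ //=; exists 0 => -[]. Qed.

Lemma ppset_lin M n (r : 'I_n -> R) x :
  ppset M (pp_lin r) x <-> \sum_j (r j : R^c) *: x 0 j = 0.
Proof.
split=> [[y /(_ 0)]|h]; last exists 0 => l.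
  by rewrite /= big_ord0 addr0; under eq_bigr do rewrite mxE.
by rewrite /= big_ord0 addr0; under eq_bigr do rewrite mxE.
Qed.

Lemma ppset_zero M n x : ppset M (pp_zero n) x <-> x = 0.
Proof.
have e l : \sum_j ((1%:M : 'M[R]_n) l j : R^c) *: x 0 j = x 0 l.
  rewrite (bigD1 l) //= mxE eqxx scale1r big1 ?addr0 // => j.
  by rewrite mxE eq_sym => /negPf->; rewrite scale0r.
split=> [[y h]|->].
  by apply/rowP => l; have := h l; rewrite /= big_ord0 addr0 e mxE.
by exists 0 => l; rewrite big1 ?add0r => [|j _];
  rewrite ?big_ord0 // [X in _ *: X]mxE scaler0.
Qed.

Lemma ppset_and M n (f g : ppformula R n) :
  ppset M (pp_and f g) = ppset M f `&` ppset M g.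
Proof.
apply/seteqP; split=> x.
  case=> y h; split.
    exists (lsubmx y) => l; have := h (lshift _ l).
    rewrite /= big_split_ord /= [X in _ + (_ + X)]big1 ?addr0 => [|k _]; last first.
      by rewrite block_mxEur mxE scale0r.
    congr (_ + _ = 0); apply: eq_bigr => k _; first by rewrite col_mxEu.
    by rewrite block_mxEul mxE.
  exists (rsubmx y) => l; have := h (rshift _ l).
  rewrite /= big_split_ord /= [X in _ + (X + _)]big1 ?add0r => [|k _]; last first.
    by rewrite block_mxEdl mxE scale0r.
  congr (_ + _ = 0); apply: eq_bigr => k _; first by rewrite col_mxEd.
  by rewrite block_mxEdr mxE.
case=> -[y fy] [z gz]; exists (row_mx y z) => l.
rewrite /= big_split_ord /= -(splitK l); case: (fintype.split l) => k /=.
  rewrite [X in _ + (_ + X)]big1 ?addr0 => [|j _]; last first.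
    by rewrite block_mxEur mxE scale0r.
  rewrite -[RHS](fy k); congr (_ + _); apply: eq_bigr => j _.
    by rewrite col_mxEu.
  by rewrite block_mxEul row_mxEl.
rewrite [X in _ + (X + _)]big1 ?add0r => [|j _]; last first.
  by rewrite block_mxEdl mxE scale0r.
rewrite -[RHS](gz k); congr (_ + _); apply: eq_bigr => j _.
  by rewrite col_mxEd.
by rewrite block_mxEdr row_mxEr.
Qed.

Lemma ppset_sub M n m (p : 'I_n -> 'I_m) (f : ppformula R n) x :
  ppset M (pp_sub p f) x <-> ppset M f (colsub p x).
Proof.
have e l : \sum_i (pp_free (pp_sub p f) l i : R^c) *: x 0 i =
           \sum_j (pp_free f l j : R^c) *: colsub p x 0 j.
  rewrite (partition_big p predT) //=; apply: eq_bigr => i _.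
  rewrite mxE (scaler_suml (R := R^c)); apply: eq_bigr => j /eqP <-.
  by rewrite mxE.
by split=> -[y h]; exists y => l; have := h l; rewrite e.
Qed.

Lemma ppset_ex M m n (f : ppformula R (m + n)) x :
  ppset M (pp_ex f) x <-> exists y, ppset M f (row_mx y x).
Proof.
have e (y : 'rV_m) (z : 'rV_(pp_nbound f)) l :
   \sum_j (pp_free (pp_ex f) l j : R^c) *: x 0 j +
   \sum_k (pp_bound (pp_ex f) l k : R^c) *: (row_mx y z) 0 k =
   \sum_j (pp_free f l j : R^c) *: (row_mx y x) 0 j +
   \sum_k (pp_bound f l k : R^c) *: z 0 k.
  rewrite [in LHS]/= !big_split_ord /= addrA [X in X + _]addrC.
  congr (_ + _ + _); apply: eq_bigr => j _.
  - by rewrite !row_mxEl mxE.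
  - by rewrite row_mxEr mxE.
  - by rewrite !row_mxEr.
split=> [[yz h]|[y [z h]]].
  by exists (lsubmx yz), (rsubmx yz) => l; rewrite -e hsubmxK; apply: h.
by exists (row_mx y z) => l; rewrite e.
Qed.

Lemma ppset_eqs M n k (p q : 'I_k -> 'I_n) x :
  ppset M (pp_eqs p q) x <-> colsub p x = colsub q x.
Proof.
have sumE j : \sum_i ((i == j)%:R : R^c) *: x 0 i = x 0 j.
  rewrite (bigD1 j) //= eqxx scale1r big1 ?addr0 // => i /negPf->.
  by rewrite scale0r.
have e l : \sum_i ((pp_free (pp_eqs p q) l i : R^c) *: x 0 i) =
    colsub p x 0 l - colsub q x 0 l.
  rewrite !mxE -2!sumE -sumrB; apply: eq_bigr => i _.
  by rewrite mxE -scalerBl.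
split=> [[y h]|h].
  apply/rowP => l; apply/eqP; rewrite -subr_eq0 -e; apply/eqP.
  by have := h l; rewrite /= big_ord0 addr0.
by exists 0 => l; rewrite e h subrr add0r big_ord0.
Qed.

Lemma ppset_image M n m (p : 'I_n -> 'I_m) (f : ppformula R m) :
  ppset M (pp_image p f) = colsub p @` ppset M f.
Proof.
have e (y : 'rV_m) (x : 'rV_n) : ppset M (pp_and (pp_sub (lshift n) f)
    (pp_eqs (lshift n \o p) (@rshift m n))) (row_mx y x) <->
    ppset M f y /\ colsub p y = x.
  by rewrite ppset_and /setI /= ppset_sub ppset_eqs colsub_l -lsubE -rsubE
    row_mxKl row_mxKr.
apply/seteqP; split=> x; rewrite /pp_image ppset_ex.
  by case=> y /e[fy <-]; exists y.
by case=> y fy yx; exists y; apply/e.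
Qed.

Lemma ppset_lin_image M M' (g : {linear M -> M'}) n (f : ppformula R n) x :
  ppset M f x -> ppset M' f (map_mx g x).
Proof.
case=> y h; exists (map_mx g y) => l; have := congr1 g (h l).
rewrite linear0 linearD !linear_sum => e; rewrite -[RHS]e.
by congr (_ + _); apply: eq_bigr => j _; rewrite mxE linearZ.
Qed.

Lemma ppset_subgroup M n (f : ppformula R n) : subgroup (ppset M f).
Proof.
split=> [|x x' [y h] [y' h']].
  by exists 0 => l; rewrite !big1 ?addr0 // => j _; rewrite mxE scaler0.
exists (y - y') => l.
have e := congr2 (fun u v => u - v) (h l) (h' l); rewrite subr0 in e.
rewrite -[RHS]e opprD addrACA; congr (_ + _); rewrite -sumrB; apply: eq_bigr => j _;
  by rewrite !mxE scalerBr.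
Qed.

(** The empty set is included, which makes pp-cosets stable under intersection and under fibres. *)
Definition ppcoset M n (C : set 'rV[M]_n) :=
  exists f : ppformula R n, coset_of (ppset M f) C.

Section Module.
Variable M : lmodType R^c.

Lemma ppcoset_ppset n (f : ppformula R n) x :
  ppcoset [set y | ppset M f (y - x)].
Proof. by exists f; apply/coset_of_translate/ppset_subgroup. Qed.

Lemma ppcoset_set1 n (x : 'rV[M]_n) : ppcoset [set x].
Proof.
have := ppcoset_ppset (pp_zero n) x; congr ppcoset; apply/seteqP; split=> y /=.
  by move=> /ppset_zero/eqP; rewrite subr_eq0 => /eqP.
by move=> ->; apply/ppset_zero; rewrite subrr.
Qed.

Lemma ppcosetT n : ppcoset [set: 'rV[M]_n].
Proof. by exists (pp_true n) => x _ y; rewrite ppset_true. Qed.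

Lemma ppcosetI n (C D : set 'rV[M]_n) :
  ppcoset C -> ppcoset D -> ppcoset (C `&` D).
Proof.
move=> [f fC] [g gD]; exists (pp_and f g) => x [Cx Dx] y.
by rewrite ppset_and; split=> -[h1 h2];
  split; by [apply/(fC x Cx)|apply/(gD x Dx)].
Qed.

Lemma ppcoset_sub n m (p : 'I_n -> 'I_m) (C : set 'rV[M]_n) :
  ppcoset C -> ppcoset [set x | C (colsub p x)].
Proof.
move=> [f fC]; exists (pp_sub p f) => x /= Cx y.
rewrite (fC _ Cx) ppset_sub; split; congr ppset;
  by apply/rowP => i; rewrite !mxE.
Qed.

Lemma ppcosetX n m (C : set 'rV[M]_n) (D : set 'rV[M]_m) :
  ppcoset C -> ppcoset D -> ppcoset (prodset C D).
Proof.
move=> pC pD; have := ppcosetI (ppcoset_sub (lshift m) pC)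
  (ppcoset_sub (@rshift n m) pD).
by congr ppcoset; apply/seteqP; split=> z; rewrite /prodset /= lsubE rsubE.
Qed.

Lemma ppcoset_image n m (p : 'I_n -> 'I_m) (f : ppformula R m)
    (C : set 'rV[M]_m) :
  coset_of (ppset M f) C -> coset_of (ppset M (pp_image p f)) (colsub p @` C).
Proof.
move=> fC _ [z Cz <-] y; rewrite ppset_image; split=> [[w Cw <-]|[w fw wE]].
  exists (w - z); first exact/(fC z Cz).
  by apply/rowP => i; rewrite !mxE.
exists (w + z); first by apply/(fC z Cz); rewrite addrK.
rewrite -[RHS](subrK (colsub p z)) -wE; by apply/rowP => i; rewrite !mxE.
Qed.

Lemma ppcoset_ex m n (C : set 'rV[M]_(m + n)) :
  ppcoset C -> ppcoset [set x | exists y, C (row_mx y x)].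
Proof.
move=> [f fC]; exists (pp_ex f) => x [y Cyx] x'.
rewrite ppset_ex; split=> [[y' Cyx']|[y' fyx]].
  by exists (y' - y); rewrite -add_row_mx -opp_row_mx; apply/fC.
exists (y' + y); apply/(fC _ Cyx).
by rewrite opp_row_mx add_row_mx addrK.
Qed.

Lemma definable_translation n (x : 'rV[M]_n) :
  definable [set z : 'rV[M]_(n + n) | rsubmx z = lsubmx z - x].
Proof.
have : definable [set z : 'rV[M]_(n + n) |
    forall j, z 0 (rshift n j) = z 0 (lshift n j) - x 0 j].
  apply: definable_all => j.
  by exists (Eq (Var (rshift n j)) (Add (Var (lshift n j)) (Opp (Cst (x 0 j))))).
congr definable; apply/seteqP; split=> z /= h.
  by apply/rowP => j; rewrite !mxE.
by move=> j; have /rowP/(_ j) := h; rewrite !mxE.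
Qed.

Lemma definable_translate n (A : set 'rV[M]_n) x :
  definable A -> definable [set y | A (y - x)].
Proof.
move=> dA; have := definable_ex (definableI (definable_translation x)
  (definable_sub (@rshift n n) dA)).
congr definable; apply/seteqP; split=> y /=.
  by case=> z; rewrite -rsubE row_mxKl row_mxKr => -[->].
by move=> Ay; exists (y - x); rewrite -rsubE row_mxKl row_mxKr.
Qed.

Lemma ppcoset_definable n (C : set 'rV[M]_n) : ppcoset C -> definable C.
Proof.
case=> f fC; have [->|/set0P[x Cx]] := eqVneq C set0; first exact: definable0.
by rewrite (coset_of_eq fC Cx); apply/definable_translate/ppset_definable.
Qed.

End Module.
End PPFormulas.

(** * Elimination of quantifiers *)

Section QuantifierElimination.
Variables (R : pzRingType) (M : lmodType R^c).

(** As [s] is finite, this says that [A] is a Boolean combination of members of [s], without writing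
    the combination down. *)
Definition determined (T : Type) (s : seq (set T)) (A : set T) :=
  forall x x', (forall C, C \in s -> C x <-> C x') -> A x -> A x'.

Lemma eval_affine (T : Type) (c : T -> M) n (t : term R T n) :
  exists (r : 'I_n -> R) a, forall x,
    eval c x t = \sum_j (r j : R^c) *: x 0 j + a.
Proof.
elim: t => [i|d||t [r [a ra]] u [s [b sb]]|t [r [a ra]]|t [r [a ra]] s] /=.
- exists (fun j => (j == i)%:R), 0 => x; rewrite addr0 (bigD1 i) //= eqxx.
  by rewrite scale1r big1 ?addr0 // => j /negPf->; rewrite scale0r.
- by exists (fun _ => 0), (c d) => x; rewrite big1 ?add0r // => j; rewrite scale0r.
- by exists (fun _ => 0), 0 => x; rewrite big1 ?add0r // => j; rewrite scale0r.
- exists (fun j => r j + s j), (a + b) => x; rewrite ra sb addrACA.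
  by congr (_ + _); rewrite -big_split; apply: eq_bigr => j; rewrite scalerDl.
- exists (fun j => - r j), (- a) => x; rewrite ra opprD -sumrN.
  by congr (_ + _); apply: eq_bigr => j; rewrite scaleNr.
exists (fun j => (s : R^c) * (r j : R^c)), ((s : R^c) *: a) => x.
rewrite ra scalerDr scaler_sumr; congr (_ + _); apply: eq_bigr => j _.
by rewrite scalerA.
Qed.

Lemma ppcoset_Eq n (t u : term R M n) :
  ppcoset [set x : 'rV[M]_n | eval id x t = eval id x u].
Proof.
have [r [a ra]] := eval_affine id (Add t (Opp u)).
exists (pp_lin r) => x /= ex y; rewrite ppset_lin.
have -> : \sum_j (r j : R^c) *: (y - x) 0 j =
    eval id y (Add t (Opp u)) - eval id x (Add t (Opp u)).
  rewrite !ra opprD addrACA subrr addr0 -sumrB; apply: eq_bigr => j _.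
  by rewrite !mxE scalerBr.
rewrite /= ex subrr subr0; split=> [->|/eqP]; first by rewrite subrr.
by rewrite subr_eq0 => /eqP.
Qed.

Lemma ppcoset_all n (s : seq (set 'rV[M]_n)) :
  (forall C, C \in s -> ppcoset C) -> ppcoset [set x | forall C, C \in s -> C x].
Proof.
elim: s => [|C s ih] ps.
  by rewrite (_ : mkset _ = setT); [apply: ppcosetT|apply/seteqP; split].
rewrite (_ : mkset _ = C `&` [set x | forall D, D \in s -> D x]).
  apply: ppcosetI; first by apply: ps; rewrite mem_head.
  by apply: ih => D Ds; apply: ps; rewrite inE Ds orbT.
apply/seteqP; split=> x /= => [h|[Cx h] D]; last first.
  by rewrite inE => /orP[/eqP ->//|/h].
by split=> [|D Ds]; apply: h; rewrite inE ?eqxx ?Ds ?orbT.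
Qed.

(** The sets [S J] record which fibres over [x] have a common point. If [x] and [x'] have the same
    record, their fibres are cosets of the same subgroups, and [coset_pattern] turns a witness over
    [x] into one over [x']. *)
Lemma determined_ex m n (s : seq (set 'rV[M]_(m + n))) A :
  (forall C, C \in s -> ppcoset C) -> determined s A ->
  exists2 s' : seq (set 'rV[M]_n), forall C, C \in s' -> ppcoset C &
    determined s' [set x | exists y, A (row_mx y x)].
Proof.
move=> ps dA; pose C (i : 'I_(size s)) := nth setT s i.
have pC i : ppcoset (C i) by apply/ps/mem_nth.
pose S (J : {set 'I_(size s)}) :=
  [set x : 'rV[M]_n | exists y : 'rV[M]_m, forall i, i \in J -> C i (row_mx y x)].
exists [seq S J | J <- enum {set 'I_(size s)}] => [_ /mapP[J _ ->]|x x' h [y Ay]].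
  apply: (@ppcoset_ex _ _ _ _ [set z | forall i, i \in J -> C i z]).
  rewrite (_ : mkset _ = [set z | forall D, D \in [seq C i | i <- enum J] -> D z]).
    by apply: ppcoset_all => _ /mapP[i _ ->].
  apply/seteqP; split=> z /= h.
    by move=> _ /mapP[i iJ ->]; apply: h; move: iJ; rewrite mem_enum.
  by move=> i iJ; apply: (h (C i)); apply: map_f; rewrite mem_enum.
have /choice[f fC] := pC.
pose fib z i := [set y : 'rV[M]_m | C i (row_mx y z)].
have fibP z i : coset_of [set y | ppset M (f i) (row_mx y 0)] (fib z i).
  move=> u /= Cu v; rewrite /fib /= (fC i _ Cu).
  by rewrite opp_row_mx add_row_mx subrr.
have [i|J|y' y'P] := @coset_pattern _ _ _ _ _ _ (fibP x) (fibP x') _ y.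
- have [G0 GB] := ppset_subgroup M (f i).
  rewrite /subgroup /=; split=> [|u v fu fv]; first by rewrite row_mx0.
  by have := GB _ _ fu fv; rewrite opp_row_mx add_row_mx subrr.
- by apply: (h (S J)); apply: map_f; rewrite mem_enum.
exists y'; apply: dA Ay => D Ds.
have /(nthP setT)[k ks <-] := Ds.
exact: (y'P (Ordinal ks)).
Qed.

Theorem quantifier_elimination n (A : set 'rV[M]_n) : definable A ->
  exists2 s : seq (set 'rV[M]_n), forall C, C \in s -> ppcoset C &
    determined s A.
Proof.
case=> f ->; elim: f => {n A} [n t u|n f [s ps ds]|n f [s ps ds] g [s' ps' ds']|
    n f [s ps ds]].
- exists [:: [set x | eval id x t = eval id x u]] => [C|x x' h].
    by rewrite inE => /eqP->; apply: ppcoset_Eq.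
  by have [] := h _ (mem_head _ _).
- exists s => // x x' h nf fx'; apply: nf; apply: ds fx' => C Cs.
  by rewrite h.
- exists (s ++ s') => [C|x x' h [fx gx]].
    by rewrite mem_cat => /orP[/ps|/ps'].
  split; [apply: ds fx|apply: ds' gx] => C Cs; apply: h;
    by rewrite mem_cat Cs ?orbT.
have [s' ps' ds'] := determined_ex ps ds; exists s' => // x x' h [a fa].
have [|y fy] := ds' x x' h; first by exists (const_mx a).
exists (y 0 0); move: fy; congr holds; congr row_mx.
by apply/rowP => i; rewrite !mxE [i]ord1.
Qed.

End QuantifierElimination.

(** * Indices of pp-subgroups *)

Section Formulas.
Variables (R : pzRingType) (T : Type).

Fixpoint exs m n : formula R T (m + n) -> formula R T n :=
  match m with
  | 0 => id
  | m'.+1 => fun f => @exs m' n (Ex f)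
  end.

Definition and_all n (I : finType) (F : I -> formula R T n) : formula R T n :=
  foldr (fun i f => And (F i) f) (Eq Zero Zero) (enum I).

Definition lin_term n k (r : 'I_k -> R) (t : 'I_k -> term R T n) :
    term R T n :=
  \big[@Add R T n/Zero]_(j < k) Act (t j) (r j).

(** Translates the matrix encoding into a first order formula, through which statements about
    pp-subgroups become visible to [theory]. *)
Definition pp_at n m (f : ppformula R n) (t : 'I_n -> term R T m) :
    formula R T m :=
  @exs (pp_nbound f) m (and_all (fun l => Eq
    (Add (lin_term (pp_free f l) (fun j => ren_term (@rshift _ m) (t j)))
         (lin_term (pp_bound f l) (fun k => Var (lshift m k))))
    Zero)).

Variables (M : lmodType R^c) (c : T -> M).

Lemma holds_exs m n (f : formula R T (m + n)) x :
  holds c (exs f) x <-> exists y, holds c f (row_mx y x).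
Proof.
elim: m f => [|m ih] f.
  have e (y : 'rV_0) : row_mx y x = x.
    apply/rowP => i; rewrite mxE; case: splitP => [[]//|j ij].
    by congr (x _ _); apply: val_inj.
  by split=> [fx|[y]]; [exists 0|]; rewrite e.
have e (a : M) (y : 'rV_m) : row_mx (const_mx a : 'rV_1) (row_mx y x) =
    row_mx (row_mx (const_mx a : 'rV_1) y) x.
  by rewrite row_mxA castmx_id.
rewrite /= (ih (Ex f)); split=> [[y [a]]|[y fy]].
  by rewrite e; exists (row_mx (const_mx a : 'rV_1) y).
exists (rsubmx (y : 'rV_(1 + m))), (y 0 0); rewrite e.
have -> : row_mx (const_mx (y 0 0) : 'rV_1) (rsubmx (y : 'rV_(1 + m))) =
    (y : 'rV_(1 + m)); last by [].
rewrite -[RHS](@hsubmxK _ 1 1 m y).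
congr row_mx; apply/rowP => i; rewrite !mxE [i]ord1.
by congr (y _ _); apply: val_inj.
Qed.

Lemma holds_and_all n (I : finType) (F : I -> formula R T n) x :
  holds c (and_all F) x <-> forall i, holds c (F i) x.
Proof.
suff : holds c (and_all F) x <-> forall i, i \in enum I -> holds c (F i) x.
  by move=> ->; split=> h i => [|_]; apply: h; rewrite mem_enum.
rewrite /and_all; elim: (enum I) => [|i s ih] /=; first by split.
rewrite ih; split=> [[Fi h] j|h]; last first.
  by split=> [|j js]; apply: h; rewrite inE ?eqxx ?js ?orbT.
by rewrite inE => /orP[/eqP ->//|/h].
Qed.

Lemma eval_lin_term n k (r : 'I_k -> R) (t : 'I_k -> term R T n) x :
  eval c x (lin_term r t) = \sum_j (r j : R^c) *: eval c x (t j).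
Proof. by rewrite /lin_term; apply: (big_morph (eval c x)). Qed.

Lemma holds_pp_at n m (f : ppformula R n) (t : 'I_n -> term R T m) x :
  holds c (pp_at f t) x <-> ppset M f (\row_j eval c x (t j)).
Proof.
rewrite /pp_at holds_exs.
have e y l : \sum_j (pp_free f l j : R^c) *:
      eval c (row_mx y x) (ren_term (@rshift (pp_nbound f) m) (t j)) +
    \sum_k (pp_bound f l k : R^c) *: (row_mx y x) 0 (lshift m k) =
    \sum_j (pp_free f l j : R^c) *: (\row_j eval c x (t j)) 0 j +
    \sum_k (pp_bound f l k : R^c) *: y 0 k.
  congr (_ + _); apply: eq_bigr => j _; last by rewrite row_mxEl.
  by rewrite eval_ren mxE -rsubE row_mxKr.
split=> -[y h]; exists y.
  by move=> l; have := (proj1 (holds_and_all _ _)) h l; rewrite /= !eval_lin_term e.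
by apply/holds_and_all => l; rewrite /= !eval_lin_term e.
Qed.

End Formulas.

(** * Indices of pp-subgroups under the hypothesis on the countable power *)

Section Index.
Variables (R : pzRingType).
Implicit Types M : lmodType R^c.

(** The classical sentence bounding below by [k] the index in [f] of its intersection with [g]; the
    [k * n] bound variables are the entries of a matrix whose rows are the [k] elements. *)
Definition index_sentence n k (f g : ppformula R n) : formula R void 0 :=
  @exs R void (k * n) 0
   (And (and_all (fun i : 'I_k =>
           pp_at f (fun l => Var (lshift 0 (mxvec_index i l)))))
        (and_all (fun p : {p : 'I_k * 'I_k | p.1 != p.2} =>
           Not (pp_at g (fun l =>
             Add (Var (lshift 0 (mxvec_index (val p).1 l)))
                 (Opp (Var (lshift 0 (mxvec_index (val p).2 l))))))))).

Lemma theory_index_sentence M n k (f g : ppformula R n) :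
  theory M (index_sentence k f g) <-> exists X : 'M[M]_(k, n),
    (forall i, ppset M f (row i X)) /\
    (forall i j, i != j -> ~ ppset M g (row i X - row j X)).
Proof.
have e (X : 'M[M]_(k, n)) (z : 'rV[M]_0) i l :
    row_mx (mxvec X) z 0 (lshift 0 (mxvec_index i l)) = row i X 0 l.
  by rewrite row_mxEl mxvecE mxE.
have ef (X : 'M[M]_(k, n)) (z : 'rV[M]_0) i :
    \row_l eval (of_void M) (row_mx (mxvec X) z)
      (Var (lshift 0 (mxvec_index i l))) = row i X.
  by apply/rowP => l; rewrite mxE /= e.
have eg (X : 'M[M]_(k, n)) (z : 'rV[M]_0) i j :
    \row_l eval (of_void M) (row_mx (mxvec X) z)
      (Add (Var (lshift 0 (mxvec_index i l)))
           (Opp (Var (lshift 0 (mxvec_index j l))))) = row i X - row j X.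
  by apply/rowP => l; rewrite mxE /= !e !mxE.
rewrite /theory /= /index_sentence holds_exs; split=> [[y []]|[X [Xf Xg]]].
  rewrite -(vec_mxK y); move: (vec_mx y) => X.
  move=> /holds_and_all hf /holds_and_all hg; exists X; split=> [i|i j ij].
    by have /holds_pp_at := hf i; rewrite ef.
  have /= := hg (exist _ (i, j) ij); rewrite holds_pp_at eg; exact.
exists (mxvec X); split; apply/holds_and_all; [move=> i /=|case=> -[i j] ij /=].
  by apply/holds_pp_at; rewrite ef.
by rewrite holds_pp_at eg; apply: Xg.
Qed.

Section PowerInjection.
Variable M : lmodType R^c.

Definition power_single_fun (k : nat) (a : M) : nat -> M :=
  fun j => if j == k then a else 0.

Lemma power_single_finsupp k a : power_single_fun k a \in @finsupp _ M.
Proof.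
apply/asboolP/(sub_finite_set _ (finite_set1 k)) => j /=.
by rewrite /power_single_fun; case: (eqVneq j k) => // _; rewrite eqxx.
Qed.

Definition power_single k (a : M) : cpower M :=
  CPower (power_single_finsupp k a).

Lemma power_single_linear k : linear (power_single k).
Proof.
move=> r u v; apply: val_inj; rewrite linearP /=; apply/funext => j.
rewrite -[RHS]/(r *: power_single_fun k u j + power_single_fun k v j).
by rewrite /power_single_fun; case: (j == k); rewrite // scaler0 addr0.
Qed.

HB.instance Definition _ k :=
  GRing.isLinear.Build _ M (cpower M) _ (power_single k) (power_single_linear k).

Definition power_proj k (u : cpower M) : M := cpower_val u k.

Lemma power_proj_linear k : linear (power_proj k).
Proof. by move=> r u v; rewrite -[LHS]/(\val (r *: u + v) k) linearP. Qed.

HB.instance Definition _ k :=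
  GRing.isLinear.Build _ (cpower M) M _ (power_proj k) (power_proj_linear k).

End PowerInjection.

(** An element of [f] outside [g], placed in different coordinates of the countable power, gives any
    number of elements of [f] that are incongruent modulo [g]. The index sentences bring this back
    to [M], where it contradicts the pigeonhole principle. *)
Lemma finindex_ppset M n (f g : ppformula R n) : theory M = theory (cpower M) ->
  finindex (ppset M f) (ppset M g) -> ppset M f `<=` ppset M g.
Proof.
move=> MM [cs csP] a fa; apply: contrapT => ga.
pose k := (size cs).+1.
have : theory (cpower M) (index_sentence k f g).
  apply/theory_index_sentence.
  exists (\matrix_(i, l) power_single i (a 0 l)).
  have rowE i : row i (\matrix_(i < k, l < n) power_single i (a 0 l)) =
      map_mx (power_single i) a by apply/rowP => l; rewrite !mxE.
  split=> [i|i j ij]; rewrite !rowE; first exact: ppset_lin_image.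
  (* The [i]-th coordinate of the difference is [a], since the copy in coordinate [j] vanishes
     there. *)
  move/(ppset_lin_image (@power_proj M i)) => h; apply: ga; move: h.
  congr ppset; apply/rowP => l; rewrite !mxE linearB /= /power_proj /=.
  by rewrite /power_single_fun eqxx (negPf (ij : i != j :> nat)) subr0.
rewrite -MM => /theory_index_sentence[X [Xf Xg]].
have /choice[c cP] : forall i, exists c : 'I_(size cs),
    ppset M g (row i X - nth 0 cs c).
  move=> i; have [_ /(nthP 0)[j js <-] h] := csP _ (Xf i).
  by exists (Ordinal js).
have /injectivePn[i [j ij cij]] : ~~ injectiveb (finfun c).
  apply/negP => /injectiveP/leq_card; rewrite !card_ord ltnn; exact.
apply: (Xg i j ij); have sG := ppset_subgroup M g.
apply: (subgroup_trans sG (cP i)); apply: subgroup_sym => //.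
by move: cij; rewrite !ffunE => ->.
Qed.

End Index.

(** * Combinations of indicator functions *)

Section Indicators.
Variable T : Type.
Implicit Types (l : seq (int * set T)) (A B C D X Y : set T).

Definition block C (ds : seq (set T)) :=
  [set x | C x /\ forall D, D \in ds -> ~ D x].

Lemma block_nil C : block C [::] = C.
Proof. by apply/seteqP; split=> x // []. Qed.

Lemma block_cons C D ds : block C (D :: ds) = block C ds `\` block (C `&` D) ds.
Proof.
apply/seteqP; split=> x [].
  move=> Cx h; split; last by case=> [[_ /h]]; rewrite mem_head => /(_ isT).
  by split=> // E Es; apply: h; rewrite inE Es orbT.
move=> [Cx h] n; split=> // E; rewrite inE => /orP[/eqP-> Dx|/h//].
by apply: n.
Qed.

(** By [block_cons], a block is the difference of two nested blocks with one removed set fewer, so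
    only intersections remain to be treated. The bound [C0] keeps all the differences inside one
    set. *)
Lemma block_diff (Q : set T -> Prop) C0 C (ds : seq (set T)) :
  (forall X Y, X `<=` C0 -> Y `<=` X -> Q X -> Q Y -> Q (X `\` Y)) ->
  (forall ds' : seq (set T), {subset ds' <= ds} ->
     Q [set x | C x /\ forall D, D \in ds' -> D x]) ->
  C `<=` C0 -> Q (block C ds).
Proof.
move=> Qdiff; elim: ds C => [|D ds ih] C QC CC0.
  rewrite block_nil; have := QC [::] (fun x => id); congr Q.
  by apply/seteqP; split=> x // [].
rewrite block_cons; apply: Qdiff.
- by move=> x [/CC0].
- by move=> x [[Cx _] h].
- by apply: ih => // ds' dss; apply: QC => x /dss xs; rewrite inE xs orbT.
apply: ih => [ds' dss|x [/CC0//]].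
have := QC (D :: ds'); rewrite (_ : [set _ | _] =
    [set x | (C `&` D) x /\ forall D', D' \in ds' -> D' x]).
  apply=> x; rewrite !inE => /orP[->//|/dss->]; exact: orbT.
apply/seteqP; split=> x [].
  move=> Cx h; split; first by split=> //; apply: h; rewrite mem_head.
  by move=> D' D's; apply: h; rewrite inE D's orbT.
by move=> [Cx Dx] h; split=> // D'; rewrite inE => /orP[/eqP->//|/h].
Qed.

(** Deciding membership in the members of [s] one after the other partitions the space into blocks,
    each contained in [A] or disjoint from it. *)
Lemma determined_ind (Q : set T -> Prop) (s : seq (set T)) A :
  determined s A -> Q set0 ->
  (forall X Y, X `|` Y `<=` A -> X `&` Y = set0 -> Q X -> Q Y -> Q (X `|` Y)) ->
  (forall cs ds : seq (set T), {subset cs <= s} -> {subset ds <= s} ->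
     let B := block [set x | forall C, C \in cs -> C x] ds in
     B !=set0 -> B `<=` A -> Q B) ->
  Q A.
Proof.
move=> dA Q0 QU QB.
(* [B] is the cell cut out by the decisions taken so far, positive for [cs] and negative for [ds];
   [r] lists the sets still to be decided. *)
suff gen (r cs ds : seq (set T)) :
    {subset cs <= s} -> {subset ds <= s} -> {subset r <= s} ->
    let B := block [set x | forall C, C \in cs -> C x] ds in
    (forall x x', B x -> B x' -> (forall C, C \in r -> C x <-> C x') ->
       A x -> A x') -> Q (A `&` B).
  have := gen s [::] [::]; rewrite block_nil /= (_ : mkset _ = setT).
    by rewrite setIT; apply=> // x x' _ _; apply: dA.
  by apply/seteqP; split.
elim: r cs ds => [|D r ih] cs ds css dss rs B dB.
  have [AB0|/set0P[x [Ax Bx]]] := eqVneq (A `&` B) set0; first by rewrite AB0.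
  have BA : B `<=` A by move=> y By; apply: dB Ax.
  by rewrite setIidr //; apply: QB => //; exists x.
have Ds : D \in s by apply: rs; rewrite mem_head.
have {}rs : {subset r <= s} by move=> C Cr; apply: rs; rewrite inE Cr orbT.
have BD : block [set x | forall C, C \in D :: cs -> C x] ds = B `&` D.
  apply/seteqP; split=> x; last first.
    move=> [[Cx nx] Dx]; split=> // C; rewrite inE => /orP[/eqP->//|].
    exact: Cx.
  move=> [Cx nx]; split; last by apply: Cx; rewrite mem_head.
  by split=> // C Ccs; apply: Cx; rewrite inE Ccs orbT.
have BnD : block [set x | forall C, C \in cs -> C x] (D :: ds) = B `\` D.
  apply/seteqP; split=> x.
    move=> [Cx nx]; split; last by apply: nx; rewrite mem_head.
    by split=> // E Es; apply: nx; rewrite inE Es orbT.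
  move=> [[Cx nx] nD]; split=> // E; rewrite inE => /orP[/eqP->//|].
  exact: nx.
have -> : A `&` B = (A `&` (B `&` D)) `|` (A `&` (B `\` D)).
  by rewrite -setIUr -{1}(setUIDK B D).
apply: QU.
- by move=> x [[]|[]].
- by rewrite -subset0 => x [[_ [_ Dx]] [_ [_ /(_ Dx)]]].
- rewrite -BD; apply: ih => //; first by move=> C; rewrite inE => /orP[/eqP->|/css].
  rewrite BD => x x' [Bx Dx] [Bx' Dx'] h; apply: dB => // C.
  by rewrite inE => /orP[/eqP->|Cr]; [split|apply: h].
rewrite -BnD; apply: ih => //; first by move=> C; rewrite inE => /orP[/eqP->|/dss].
rewrite BnD => x x' [Bx Dx] [Bx' Dx'] h; apply: dB => // C.
by rewrite inE => /orP[/eqP->|Cr]; [split=> [/Dx|/Dx']|apply: h].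
Qed.

(** A list [l] stands for a formal integer combination of sets: [ind_sum] is the function it
    represents, and [weight] applies the additive extension of [k] to it. *)
Definition ind_sum l x : int := \sum_(p <- l) p.1 * (`[< p.2 x >] : nat)%:R.

Definition weight (K : zmodType) (k : set T -> K) l : K :=
  \sum_(p <- l) k p.2 *~ p.1.

Definition opp_coefs l := [seq (- p.1, p.2) | p <- l].

Definition indicates l A := forall x, ind_sum l x = (`[< A x >] : nat)%:R.

Lemma ind_sum_cat l l' x : ind_sum (l ++ l') x = ind_sum l x + ind_sum l' x.
Proof. exact: big_cat. Qed.

Lemma ind_sum_opp l x : ind_sum (opp_coefs l) x = - ind_sum l x.
Proof. by rewrite /ind_sum big_map -sumrN; apply: eq_bigr => p; rewrite mulNr. Qed.

Lemma weight_cat (K : zmodType) (k : set T -> K) l l' :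
  weight k (l ++ l') = weight k l + weight k l'.
Proof. exact: big_cat. Qed.

Lemma weight_opp (K : zmodType) (k : set T -> K) l :
  weight k (opp_coefs l) = - weight k l.
Proof.
by rewrite /weight big_map -sumrN; apply: eq_bigr => p; rewrite mulrNz.
Qed.

Lemma indicates0 : indicates [::] set0.
Proof. by move=> x; rewrite /ind_sum big_nil asboolF. Qed.

Lemma indicates1 C : indicates [:: (1, C)] C.
Proof. by move=> x; rewrite /ind_sum big_seq1 mul1r. Qed.

Lemma indicatesU l l' X Y : X `&` Y = set0 ->
  indicates l X -> indicates l' Y -> indicates (l ++ l') (X `|` Y).
Proof.
move=> XY lX l'Y x; rewrite ind_sum_cat lX l'Y.
have : ~ (X x /\ Y x) by move=> h; have : (X `&` Y) x by []; rewrite XY.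
by rewrite asbool_or; do 2?[case: asboolP] => //= Yx Xx [].
Qed.

Lemma indicatesD l l' X Y : Y `<=` X ->
  indicates l X -> indicates l' Y -> indicates (l ++ opp_coefs l') (X `\` Y).
Proof.
move=> YX lX l'Y x; rewrite ind_sum_cat ind_sum_opp lX l'Y.
rewrite asbool_and asbool_neg; have := YX x.
by case: asboolP => Xx; case: asboolP => // Yx; rewrite ?subrr ?subr0 // => /(_ Yx).
Qed.

Lemma maximal_set (s : seq (set T)) : s != [::] ->
  exists2 C, C \in s & forall D, D \in s -> C `<=` D -> D = C.
Proof.
elim: s => // A s ih _; have [->|/ih[C Cs Cmax]] := eqVneq s [::].
  by exists A => [|D]; rewrite inE // => /eqP.
case: (pselect (C `<=` A)) => [CA|nCA]; last first.
  exists C => [|D]; rewrite inE ?Cs ?orbT // => /orP[/eqP-> //|/Cmax//].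
exists A => [|D]; rewrite inE ?eqxx // => /orP[/eqP //|Ds AD].
have DC := Cmax D Ds (subset_trans CA AD).
by apply/seteqP; split=> //; rewrite DC.
Qed.

(* Indicators of sets none of which is covered by finitely many others that do
   not contain it are linearly independent: look at a point of a maximal set
   outside all the others. *)
Lemma weight_eq0 (K : zmodType) (k : set T -> K) (U : set (set T)) l :
  (forall C (ds : seq (set T)), U C -> (forall D, D \in ds -> U D) -> C !=set0 ->
     (forall D, D \in ds -> ~ C `<=` D) -> block C ds !=set0) ->
  k set0 = 0 -> (forall p, p \in l -> U p.2) ->
  (forall x, ind_sum l x = 0) -> weight k l = 0.
Proof.
move=> cover k0; have [n] := ubnP (size l); elim: n l => // n ih l ln lU l0.
have [->|nl] := eqVneq l [::]; first by rewrite /weight big_nil.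
have [|C Cl Cmax] := @maximal_set (unzip2 l); first by case: (l) nl.
(* [C] may occur several times in [l], so its coefficient is the sum over [l1]. *)
pose l1 := [seq p <- l | p.2 == C]; pose l2 := [seq p <- l | p.2 != C].
have split_sum (V : zmodType) (F : int * set T -> V) :
    \sum_(p <- l) F p = \sum_(p <- l1) F p + \sum_(p <- l2) F p.
  by rewrite (bigID (fun p => p.2 == C)) !big_filter.
have unzipU D : D \in unzip2 l -> U D by case/mapP=> p /lU Up ->.
have l1E (V : zmodType) (F : int * set T -> V) (z : V) :
    (forall a, F (a, C) = z *~ a) ->
    \sum_(p <- l1) F p = z *~ \sum_(p <- l1) p.1.
  move=> FE; rewrite mulrz_sumr [in LHS]big_seq [in RHS]big_seq.
  apply: eq_bigr => -[a D]; rewrite mem_filter => /andP[/eqP /= -> _].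
  exact: FE.
(* At a point of [C] outside all the sets of [l2], only [l1] contributes. The empty set has no
   points but also has weight 0. *)
have C0 : C = set0 \/ \sum_(p <- l1) p.1 = 0.
  have [->|/set0P C0] := eqVneq C set0; [by left|right].
  have [|D|x [Cx nx]] := cover C (unzip2 l2) (unzipU _ Cl) _ C0.
  - by move=> D /mapP[p]; rewrite mem_filter => /andP[_ /lU Up] ->.
  - move=> /mapP[p]; rewrite mem_filter => /andP[pC pl ->] CD.
    by move/eqP: pC; apply; apply: Cmax => //; apply/mapP; exists p.
  have := l0 x; rewrite /ind_sum split_sum (@l1E _ _ 1) => [|a]; last first.
    by rewrite asboolT //= mulr1 intz.
  have -> : \sum_(p <- l2) p.1 * (`[< p.2 x >] : nat)%:R = 0.
    rewrite big_seq big1 // => p pl.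
    by rewrite asboolF ?mulr0 //; apply: nx; apply: map_f.
  by rewrite addr0 intz.
have l2n : (size l2 < n)%N.
  rewrite -ltnS; apply: leq_trans _ ln; rewrite ltnS.
  rewrite size_filter -(count_predC (fun p => p.2 == C) l) -[X in (X < _)%N]add0n.
  rewrite ltn_add2r -has_count; apply/hasP.
  by case/mapP: Cl => p pl CE; exists p; rewrite //= CE.
rewrite /weight split_sum (l1E _ _ (k C)) //.
rewrite (_ : k C *~ _ = 0) ?add0r; last first.
  by case: C0 => ->; rewrite ?k0 ?mul0rz ?mulr0z.
apply: ih => // [p|x]; first by rewrite mem_filter => /andP[_ /lU].
have := l0 x; rewrite /ind_sum split_sum.
rewrite (l1E _ _ (`[< C x >] : nat)%:R) => [|a]; last by rewrite /= mulrC mulrzz.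
case: C0 => [->|->]; last by rewrite mulr0z add0r.
by rewrite asboolF // mul0rz add0r.
Qed.

End Indicators.

(** Quantifier elimination as an induction principle: definable sets arise from pp-cosets by nested
    differences and disjoint unions. The hereditary condition [good] serves for injectivity of a
    projection, which has to be extended from a block to its whole coset. *)
Lemma definable_ind (R : pzRingType) (M : lmodType R^c) n (A : set 'rV[M]_n)
    (good Q : set 'rV[M]_n -> Prop) :
  definable A -> Q set0 ->
  (forall X Y, X `|` Y `<=` A -> X `&` Y = set0 -> Q X -> Q Y -> Q (X `|` Y)) ->
  (forall C X, X `<=` C -> good C -> good X) ->
  (forall C (ds : seq (set _)), ppcoset C -> (forall D, D \in ds -> ppcoset D) ->
     block C ds !=set0 -> block C ds `<=` A -> good C) ->
  (forall X Y, good X -> Y `<=` X -> Q X -> Q Y -> Q (X `\` Y)) ->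
  (forall C, ppcoset C -> good C -> Q C) -> Q A.
Proof.
move=> /quantifier_elimination[s ps dA] Q0 QU goodS goodB QD QC.
apply: (determined_ind dA Q0 QU) => cs ds css dss /= B0 BA.
have pds D : D \in ds -> ppcoset D by move/dss/ps.
have pcs : ppcoset [set x | forall C, C \in cs -> C x].
  by apply: ppcoset_all => C /css/ps.
have gC := goodB _ _ pcs pds B0 BA.
apply: (@block_diff _ _ [set x | forall C, C \in cs -> C x]) => // [X Y XC|ds' dss'].
  by apply: QD; apply: goodS gC.
apply: QC; last by apply: goodS gC => x [].
apply: ppcosetI pcs _; apply: ppcoset_all => D /dss'; exact: pds.
Qed.

(** * Traces on a pure submodule *)

Section DefinableSets.
Variables (R : pzRingType) (M : lmodType R^c).

Lemma definableD n (A B : set 'rV[M]_n) :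
  definable A -> definable B -> definable (A `\` B).
Proof. by move=> dA dB; apply: definableI dA (definableC dB). Qed.

Lemma defiso_translate n (A : set 'rV[M]_n) x :
  definable A -> defiso [set y | A (y - x)] A.
Proof.
move=> dA; exists (fun y => y - x).
  split=> [y //|y z _ _ /addIr //|y Ay].
  by exists (y + x); rewrite /= addrK.
have := definableI (definable_translation x) (definable_sub (@rshift n n) dA).
congr definable; apply/seteqP; split=> z /=.
  by rewrite -rsubE => -[e Az]; exists (lsubmx z); rewrite -e ?hsubmxK.
by case=> y Ay <-; rewrite -rsubE row_mxKl row_mxKr.
Qed.

(** Made total, with default 0, so that sets can be rewritten without carrying proofs of
    definability. *)
Definition class_in_K0 n (A : set 'rV[M]_n.+1) : K0 M :=
  match pselect (definable A) with
  | left dA => K0_class (DefSet dA)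
  | right _ => 0
  end.

Lemma class_in_K0E n (A : defset M n.+1) : class_in_K0 A = K0_class A.
Proof.
rewrite /class_in_K0; case: pselect => [dA|]; last by case; apply: defsetP.
by congr to_groth; apply/class_ofP; apply: defiso_refl; apply: defsetP.
Qed.

Lemma class_in_K0_iso n m (A : set 'rV[M]_n.+1) (B : set 'rV[M]_m.+1) :
  definable A -> definable B -> defiso A B -> class_in_K0 A = class_in_K0 B.
Proof.
move=> dA dB AB; rewrite (class_in_K0E (DefSet dA)) (class_in_K0E (DefSet dB)).
by congr to_groth; apply/class_ofP.
Qed.

Lemma class_in_K0_0 n : class_in_K0 (set0 : set 'rV[M]_n.+1) = 0.
Proof.
by rewrite (class_in_K0E (defset0 M n.+1)) /K0_class class_of_set0 // raddf0.
Qed.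

Lemma class_in_K0_1 n (a : 'rV[M]_n.+1) : class_in_K0 [set a] = 1.
Proof.
rewrite (class_in_K0E (defset1 a)) -[RHS](rmorph1 (@to_groth (defclass M))).
by congr to_groth; apply/class_ofP/defiso_pt.
Qed.

Lemma class_in_K0U n (A B : set 'rV[M]_n.+1) : definable A -> definable B ->
  A `&` B = set0 -> class_in_K0 (A `|` B) = class_in_K0 A + class_in_K0 B.
Proof.
move=> dA dB AB; rewrite (class_in_K0E (DefSet dA)) (class_in_K0E (DefSet dB)).
rewrite (class_in_K0E (defsetU (DefSet dA) (DefSet dB))).
rewrite -[RHS](raddfD (@to_groth (defclass M))); congr to_groth.
exact: (esym (@class_addE _ _ _ (DefSet dA) (DefSet dB) AB)).
Qed.

Lemma class_in_K0D n (A B : set 'rV[M]_n.+1) : definable A -> definable B ->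
  B `<=` A -> class_in_K0 (A `\` B) = class_in_K0 A - class_in_K0 B.
Proof.
move=> dA dB BA; apply/eqP; rewrite eq_sym subr_eq -class_in_K0U //.
- by rewrite setUC setDUK.
- exact: definableD.
by rewrite setDE -setIA setICl setI0.
Qed.

Lemma class_in_K0X n m (A : set 'rV[M]_n.+1) (B : set 'rV[M]_m.+1) :
  definable A -> definable B ->
  class_in_K0 (prodset A B : set 'rV[M]_(n + m.+1).+1) =
  class_in_K0 A * class_in_K0 B.
Proof.
move=> dA dB; rewrite (class_in_K0E (DefSet dA)) (class_in_K0E (DefSet dB)).
rewrite (@class_in_K0E (n + m.+1)%N (defsetX (DefSet dA) (DefSet dB))).
rewrite -[RHS](rmorphM (@to_groth (defclass M))); congr to_groth.
exact: (esym (class_mulE (DefSet dA) (DefSet dB))).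
Qed.

End DefinableSets.

(** * Classes of the traces of pp-cosets *)

Section PureRestriction.
Variables (R : pzRingType) (N M : lmodType R^c) (i : {linear N -> M}).
Hypothesis i_pure : pure i.

(** For a nonempty coset this recovers its subgroup without choosing a formula; for the empty set it
    is empty, so that the trace class is 0. *)
Definition directions (V : zmodType) (C : set V) :=
  [set v | exists x y, [/\ C x, C y & v = x - y]].

Lemma directions_coset (V : zmodType) (G C : set V) x :
  subgroup G -> coset_of G C -> C x -> directions C = G.
Proof.
move=> sG GC Cx; apply/seteqP; split=> [v [y [z [Cy Cz ->]]]|v Gv].
  exact/(GC z Cz).
exists (v + x), x; split=> //; last by rewrite addrK.
by apply/(GC x Cx); rewrite addrK.
Qed.

(* The class in [K0 N] of the trace on [N] of the subgroup parallel to [C];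
   [C] itself may miss [N]. *)
Definition trace_class n (C : set 'rV[M]_n.+1) : K0 N :=
  class_in_K0 (map_mx i @^-1` directions C).

Lemma trace_class0 n : trace_class (set0 : set 'rV[M]_n.+1) = 0.
Proof.
rewrite /trace_class (_ : _ @^-1` _ = set0) ?class_in_K0_0 //.
by apply/seteqP; split=> x // [y [z []]].
Qed.

(** Purity enters here: the trace of the subgroup is defined in [N] by the same formula. *)
Lemma trace_classE n (f : ppformula R n.+1) C x :
  coset_of (ppset M f) C -> C x -> trace_class C = class_in_K0 (ppset N f).
Proof.
move=> fC Cx; rewrite /trace_class (directions_coset _ fC Cx).
  by case: i_pure => _ ->.
exact: ppset_subgroup.
Qed.

Lemma trace_class_set1 n (x : 'rV[M]_n.+1) : trace_class [set x] = 1.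
Proof.
have zP : coset_of (ppset M (pp_zero R n.+1)) [set x].
  move=> _ -> y; rewrite ppset_zero; split=> [->|/eqP]; first by rewrite subrr.
  by rewrite subr_eq0 => /eqP.
rewrite (trace_classE zP (erefl x)) -(class_in_K0_1 (0 : 'rV[N]_n.+1)).
congr class_in_K0; apply/seteqP; split=> y; first by move/ppset_zero.
by move=> ->; apply/ppset_zero.
Qed.

Lemma trace_classX n m (C : set 'rV[M]_n.+1) (D : set 'rV[M]_m.+1) :
  ppcoset C -> ppcoset D ->
  trace_class (prodset C D : set 'rV[M]_(n + m.+1).+1) =
  trace_class C * trace_class D.
Proof.
move=> [f fC] [g gD].
have [->|/set0P[x Cx]] := eqVneq C set0.
  rewrite trace_class0 mul0r (_ : prodset _ _ = set0) ?trace_class0 //.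
  by apply/seteqP; split=> z // [].
have [->|/set0P[y Dy]] := eqVneq D set0.
  rewrite trace_class0 mulr0 (_ : prodset _ _ = set0) ?trace_class0 //.
  by apply/seteqP; split=> z // [].
pose h : ppformula R (n + m.+1).+1 :=
  pp_and (pp_sub (lshift m.+1) f) (pp_sub (@rshift n.+1 m.+1) g).
have hE (L : lmodType R^c) : ppset L h = prodset (ppset L f) (ppset L g).
  rewrite /h ppset_and; apply/seteqP.
  by split=> z; rewrite /prodset /= !ppset_sub lsubE rsubE.
have hCD : coset_of (ppset M h) (prodset C D).
  move=> u [Cu Du] v; rewrite hE /prodset /= (fC _ Cu) (gD _ Du).
  rewrite !(lsubE, rsubE); split=> -[h1 h2]; split;
    [move: h1|move: h2|move: h1|move: h2];
    by congr ppset; apply/rowP => j; rewrite !mxE.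
rewrite (trace_classE fC Cx) (trace_classE gD Dy).
rewrite (@trace_classE _ h _ (row_mx x y) hCD); last first.
  by rewrite /prodset /= row_mxKl row_mxKr.
by rewrite hE class_in_K0X //; apply: ppset_definable.
Qed.

(** Injectivity on [C] passes to the parallel subgroup and, as [i] is injective, to its trace. By
    purity for [pp_image p f], the trace of the projected subgroup is the projection of the
    trace. *)
Lemma trace_class_image n m (p : 'I_n.+1 -> 'I_m.+1) (C : set 'rV[M]_m.+1) :
  ppcoset C -> {in C &, injective (colsub p)} ->
  trace_class (colsub p @` C) = trace_class C.
Proof.
move=> [f fC] pI; have [->|/set0P[x Cx]] := eqVneq C set0.
  by rewrite image_set0 !trace_class0.
rewrite (trace_classE fC Cx).
rewrite (@trace_classE _ (pp_image p f) _ (colsub p x)); last first.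
- by exists x.
- exact: ppcoset_image.
apply/esym; apply: class_in_K0_iso; try exact: ppset_definable.
apply: (@defiso_sub _ _ _ _ p); first exact: ppset_definable.
rewrite ppset_image; split=> [z fz|z z' /set_mem fz /set_mem fz' e|//].
  by exists z.
have Ci u : ppset N f u -> C (map_mx i u + x).
  by move=> fu; apply/(fC x Cx); rewrite addrK; apply: ppset_lin_image.
have /addIr /rowP e' : map_mx i z + x = map_mx i z' + x.
  apply: pI; rewrite ?inE; try exact: Ci.
  apply/rowP => j; move/rowP/(_ j): e; rewrite !mxE => ->; done.
apply/rowP => j; case: i_pure => iI _; apply: iI.
by have := e' j; rewrite !mxE.
Qed.

End PureRestriction.

(** * The trace map on definable sets of [M] *)

Section Restriction.
Variables (R : pzRingType) (N M : lmodType R^c) (i : {linear N -> M}).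
Hypothesis i_pure : pure i.
Hypothesis M_power : theory M = theory (cpower M).

Lemma ppcoset_cover n (C : set 'rV[M]_n) (ds : seq (set 'rV[M]_n)) :
  ppcoset C -> (forall D, D \in ds -> ppcoset D) -> C !=set0 ->
  (forall D, D \in ds -> ~ C `<=` D) -> block C ds !=set0.
Proof.
move=> [f fC] pds [x Cx] nds.
(* Only the sets that meet [C] can be treated by index: one disjoint from [C] may be parallel to it.
   If [D] meets [C] without containing it, then the subgroup of [C] is not contained in that of [D],
   so the index is infinite. *)
pose ds' := [seq D <- ds | `[< exists z, C z /\ D z >] ].
have [D|h fh nh] := @neumann _ (ppset M f) ds' (ppset_subgroup M f) _ x.
  rewrite mem_filter => /andP[/asboolP[z [Cz Dz]] Ds].
  have [g gD] := pds D Ds; exists (ppset M g); split=> //.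
    exact: ppset_subgroup.
  move=> /(finindex_ppset M_power) fg; apply: (nds D Ds) => y Cy.
  by apply/(gD z Dz)/fg/(fC z Cz).
have Cxh : C (x + h) by apply/(fC x Cx); rewrite addrC addKr.
exists (x + h); split=> // D Ds Dxh; apply: (nh D _ Dxh).
by rewrite mem_filter Ds andbT; apply/asboolP; exists (x + h).
Qed.

Definition ppcosets n (l : seq (int * set 'rV[M]_n)) :=
  forall p, p \in l -> ppcoset p.2.

Lemma ppcosets_cat n (l l' : seq (int * set 'rV[M]_n)) :
  ppcosets l -> ppcosets l' -> ppcosets (l ++ l').
Proof. by move=> pl pl' p; rewrite mem_cat => /orP[/pl|/pl']. Qed.

Lemma ppcosets_opp n (l : seq (int * set 'rV[M]_n)) :
  ppcosets l -> ppcosets (opp_coefs l).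
Proof. by move=> pl _ /mapP[p /pl pp ->]. Qed.

Lemma ppcosets1 n (C : set 'rV[M]_n) a : ppcoset C -> ppcosets [:: (a, C)].
Proof. by move=> pC p; rewrite inE => /eqP->. Qed.

Lemma indicates_definable n (A : set 'rV[M]_n) :
  definable A -> exists l, ppcosets l /\ indicates l A.
Proof.
move=> dA; apply: (definable_ind
  (Q := fun X => exists l, ppcosets l /\ indicates l X)
  (good := fun=> True) dA) => //.
- by exists [::]; split=> //; apply: indicates0.
- move=> X Y _ XY [l [pl lX]] [l' [pl' l'Y]]; exists (l ++ l').
  by split; [apply: ppcosets_cat|apply: indicatesU].
- move=> X Y _ YX [l [pl lX]] [l' [pl' l'Y]]; exists (l ++ opp_coefs l').
  split; last exact: indicatesD.
  exact/ppcosets_cat/ppcosets_opp.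
move=> C pC _; exists [:: (1, C)]; split; first exact: ppcosets1.
exact: indicates1.
Qed.

(* If [colsub p] identified two points of [C], the fibre through a point of the
   block would be infinite and not covered by the removed cosets. *)
Lemma injective_on_block n m (p : 'I_n -> 'I_m) (C : set 'rV[M]_m)
    (ds : seq (set 'rV[M]_m)) :
  ppcoset C -> (forall D, D \in ds -> ppcoset D) -> block C ds !=set0 ->
  {in block C ds &, injective (colsub p)} -> {in C &, injective (colsub p)}.
Proof.
move=> pC pds [x [Cx nx]] pI z z'; rewrite !inE => Cz Cz' zz'.
apply: contrapT => nzz'; have [f fC] := pC.
pose g := pp_and f (pp_sub p (pp_zero R n)).
have gE y : ppset M g y <-> ppset M f y /\ colsub p y = 0.
  by rewrite ppset_and /setI /= ppset_sub ppset_zero.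
have sg := ppset_subgroup M g.
(* [g] defines the kernel of [colsub p] in the subgroup of [C]. Removing [[set x]] as well makes [y]
   differ from [x]; that singleton is not the whole fibre, because of [z - z' + x]. *)
have [|D||D|y [gy ny]] :=
    @ppcoset_cover _ [set y | ppset M g (y - x)] ([set x] :: ds).
- exact: ppcoset_ppset.
- rewrite inE => /orP[/eqP->|/pds//]; exact: ppcoset_set1.
- by exists x; rewrite /= subrr; case: sg.
- rewrite inE => /orP[/eqP->|Ds] sD; last first.
    by apply: (nx D Ds); apply: sD; rewrite /= subrr; case: sg.
  have /sD /eqP : ppset M g (z - z' + x - x).
    rewrite addrK gE; split; first exact/(fC z' Cz').
    by apply/rowP => j; move/rowP/(_ j): zz'; rewrite !mxE => ->; rewrite subrr.
  by rewrite -subr_eq0 addrK subr_eq0 => /eqP.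
have [fy py] := proj1 (gE _) gy.
apply: (ny [set x]); rewrite ?mem_head //; apply: pI; rewrite ?inE.
- split=> [|D Ds]; first exact/(fC x Cx).
  by apply: ny; rewrite inE Ds orbT.
- by [].
by apply/rowP => j; move/rowP/(_ j): py; rewrite !mxE => /eqP; rewrite subr_eq0 => /eqP.
Qed.

Local Notation k := (trace_class i).

Lemma weight_indicates n (l l' : seq (int * set 'rV[M]_n.+1)) A :
  ppcosets l -> ppcosets l' -> indicates l A -> indicates l' A ->
  weight (@k n) l = weight (@k n) l'.
Proof.
move=> pl pl' lA l'A; apply/eqP; rewrite -subr_eq0 -weight_opp -weight_cat.
apply/eqP/(@weight_eq0 _ _ _ (@ppcoset R M n.+1)).
- exact: ppcoset_cover.
- exact: trace_class0.
- exact/ppcosets_cat/ppcosets_opp.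
by move=> x; rewrite ind_sum_cat ind_sum_opp lA l'A subrr.
Qed.

(** Independent of the combination by [weight_indicates]; by [indicates_definable] the default is
    never reached on a definable set. *)
Definition K0_trace n (A : set 'rV[M]_n.+1) : K0 N :=
  xget 0 [set z | exists l, [/\ ppcosets l, indicates l A & z = weight (@k n) l]].

Lemma K0_traceE n (A : set 'rV[M]_n.+1) l :
  ppcosets l -> indicates l A -> K0_trace A = weight (@k n) l.
Proof.
move=> pl lA; rewrite /K0_trace; set S := (X in xget _ X).
have : S (xget 0 S) by apply: xgetPex; exists (weight (@k n) l), l.
by case=> l' [pl' l'A ->]; apply: weight_indicates l'A lA.
Qed.

Lemma K0_trace_ppcoset n (C : set 'rV[M]_n.+1) :
  ppcoset C -> K0_trace C = k C.
Proof.
move=> pC; rewrite (K0_traceE (@ppcosets1 _ _ 1 pC) (indicates1 C)).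
by rewrite /weight big_seq1 mulr1z.
Qed.

Lemma K0_trace0 n : K0_trace (set0 : set 'rV[M]_n.+1) = 0.
Proof. by rewrite (@K0_traceE _ _ [::]) ?/weight ?big_nil //; apply: indicates0. Qed.

Lemma K0_traceU n (A B : set 'rV[M]_n.+1) : definable A -> definable B ->
  A `&` B = set0 -> K0_trace (A `|` B) = K0_trace A + K0_trace B.
Proof.
move=> /indicates_definable[l [pl lA]] /indicates_definable[l' [pl' l'B]] AB.
rewrite (K0_traceE pl lA) (K0_traceE pl' l'B) -weight_cat.
by apply: K0_traceE; [apply: ppcosets_cat|apply: indicatesU].
Qed.

Lemma K0_traceX n m (A : set 'rV[M]_n.+1) (B : set 'rV[M]_m.+1) :
  definable A -> definable B ->
  K0_trace (prodset A B : set 'rV[M]_(n + m.+1).+1) = K0_trace A * K0_trace B.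
Proof.
move=> /indicates_definable[l [pl lA]] /indicates_definable[l' [pl' l'B]].
rewrite (K0_traceE pl lA) (K0_traceE pl' l'B).
pose ll : seq (int * set 'rV[M]_(n + m.+1).+1) :=
  [seq (p.1 * q.1, prodset p.2 q.2) | p <- l, q <- l'].
rewrite (@K0_traceE _ _ ll).
- rewrite /weight big_allpairs_dep mulr_suml [LHS]big_seq [RHS]big_seq.
  apply: eq_bigr => p /pl pp; rewrite mulr_sumr [LHS]big_seq [RHS]big_seq.
  apply: eq_bigr => q /pl' pq /=.
  by rewrite trace_classX // mulrzAr mulrzAl mulrzA.
- move=> _ /allpairsP[[p q] [/pl pp /pl' pq ->]].
  exact: (@ppcosetX _ _ n.+1 m.+1 _ _ pp pq).
move=> z; rewrite /ind_sum big_allpairs_dep /=.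
transitivity (ind_sum l (lsubmx (z : 'rV_(n.+1 + m.+1))) *
              ind_sum l' (rsubmx (z : 'rV_(n.+1 + m.+1)))); last first.
  rewrite lA l'B -natrM mulnb; congr (_%:R); congr nat_of_bool.
  by rewrite -asbool_and.
rewrite /ind_sum mulr_suml; apply: eq_bigr => p _.
rewrite mulr_sumr; apply: eq_bigr => q _.
by rewrite /prodset /= asbool_and -mulnb natrM mulrACA.
Qed.

(** Combinations for [A] and for its image are built in parallel. Injectivity makes images commute
    with disjoint unions and differences, and [injective_on_block] gives it on the pp-cosets, where
    [trace_class_image] applies. *)
Lemma K0_trace_image n m (p : 'I_n.+1 -> 'I_m.+1) (A : set 'rV[M]_m.+1) :
  definable A -> {in A &, injective (colsub p)} ->
  K0_trace (colsub p @` A) = K0_trace A.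
Proof.
move=> dA pI.
suff [l [l' [pl pl' lA l'A e]]] : exists l l', [/\ ppcosets l, ppcosets l',
    indicates l A, indicates l' (colsub p @` A) &
    weight (@k n) l' = weight (@k m) l].
  by rewrite (K0_traceE pl lA) (K0_traceE pl' l'A).
apply: (definable_ind (Q := fun X => exists l l', [/\ ppcosets l, ppcosets l',
    indicates l X, indicates l' (colsub p @` X) &
    weight (@k n) l' = weight (@k m) l])
  (good := fun X => {in X &, injective (colsub p)}) dA).
- exists [::], [::]; rewrite image_set0; split=> //; try exact: indicates0.
  by rewrite /weight !big_nil.
- move=> X Y XYA XY [l [l' [pl pl' lX l'X e]]] [h [h' [ph ph' hY h'Y e']]].
  exists (l ++ h), (l' ++ h'); rewrite image_setU; split.
  + exact: ppcosets_cat.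
  + exact: ppcosets_cat.
  + exact: indicatesU.
  + apply: indicatesU => //; rewrite -subset0 => _ [[x Xx <-] [y Yy yx]].
    have yxE : y = x by apply: pI; rewrite ?inE //; apply: XYA; [right|left].
    by have : (X `&` Y) x; [split; rewrite // -yxE|rewrite XY].
  + by rewrite !weight_cat e e'.
- move=> C X XC CI x y; rewrite !inE => Xx Xy; apply: CI; rewrite inE;
    exact: XC.
- move=> C ds pC pds B0 BA; apply: injective_on_block pC pds B0 _ => x y.
  by rewrite !inE => Bx By; apply: pI; rewrite inE; apply: BA.
- move=> X Y XI YX [l [l' [pl pl' lX l'X e]]] [h [h' [ph ph' hY h'Y e']]].
  exists (l ++ opp_coefs h), (l' ++ opp_coefs h').
  have -> : colsub p @` (X `\` Y) = (colsub p @` X) `\` (colsub p @` Y).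
    apply/seteqP; split=> [_ [x [Xx nY] <-]|_ [[x Xx <-] nY]].
      split; first by exists x.
      by case=> y Yy /XI yx; apply: nY; rewrite -yx ?inE //; apply: YX.
    by exists x => //; split=> // Yx; apply: nY; exists x.
  split.
  + exact/ppcosets_cat/ppcosets_opp.
  + exact/ppcosets_cat/ppcosets_opp.
  + exact: indicatesD.
  + by apply: indicatesD => //; apply: image_subset.
  + by rewrite !weight_cat !weight_opp e e'.
move=> C pC CI; have pC' : ppcoset (colsub p @` C).
  by case: pC => f fC; exists (pp_image p f); apply: ppcoset_image.
exists [:: (1, C)], [:: (1, colsub p @` C)]; split; try exact: ppcosets1;
  try exact: indicates1.
by rewrite /weight !big_seq1 trace_class_image.
Qed.

(** The graph of the isomorphism projects injectively onto both [A] and [B], so both have the trace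
    class of the graph. *)
Lemma K0_trace_iso n m (A : set 'rV[M]_n.+1) (B : set 'rV[M]_m.+1) :
  defiso A B -> K0_trace A = K0_trace B.
Proof.
case/defisoP=> P [dP sP tP uP fP iP].
pose G : set 'rV[M]_(n.+1 + m.+1) := [set z | P (lsubmx z) (rsubmx z)].
have Gl : colsub (lshift m.+1) @` G = A.
  apply/seteqP; split=> [_ [z Gz <-]|x /tP[y Pxy]].
    by rewrite -lsubE; case: (sP _ _ Gz).
  by exists (row_mx x y); rewrite -?lsubE /G /= ?row_mxKl ?row_mxKr.
have Gr : colsub (@rshift n.+1 m.+1) @` G = B.
  apply/seteqP; split=> [_ [z Gz <-]|y /uP[x Pxy]].
    by rewrite -rsubE; case: (sP _ _ Gz).
  by exists (row_mx x y); rewrite -?rsubE /G /= ?row_mxKl ?row_mxKr.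
have Il : {in G &, injective (colsub (lshift m.+1))}.
  move=> z w; rewrite !inE /G /= -!lsubE => Gz Gw e.
  rewrite -[z]hsubmxK -[w]hsubmxK e; congr row_mx.
  by apply: fP Gz _; rewrite e.
have Ir : {in G &, injective (colsub (@rshift n.+1 m.+1))}.
  move=> z w; rewrite !inE /G /= -!rsubE => Gz Gw e.
  rewrite -[z]hsubmxK -[w]hsubmxK e; congr row_mx.
  by apply: iP Gz _; rewrite e.
rewrite -Gl -Gr.
rewrite (@K0_trace_image n (n + m.+1) (lshift m.+1) G dP Il).
exact/esym/(@K0_trace_image m (n + m.+1) (@rshift n.+1 m.+1) G dP Ir).
Qed.

End Restriction.

Lemma groth_extend (S : comPzSemiRingType) (K : comPzRingType) (f : S -> K) :
  nmod_morphism f -> monoid_morphism f ->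
  exists g : {rmorphism groth S -> K}, forall a, g (to_groth a) = f a.
Proof.
move=> fD fM; pose F1 := GRing.isNmodMorphism.Build S K f fD.
pose F2 := GRing.isMonoidMorphism.Build S K f fM.
pose F : {rmorphism S -> K} := HB.pack f F1 F2.
by have [g gE _] := groth_universal F; exists g => a; rewrite gE.
Qed.

(** Over the zero module the classes satisfy 1 + 1 = 1, which forces 1 = 0 in the Grothendieck
    ring. *)
Lemma trivial_K0 (R : pzRingType) (N : lmodType R^c) :
  (forall x : N, x = 0) -> forall y : K0 N, y = 0.
Proof.
move=> N0; have [|_ e] := @class_trivial R N.
  by case=> c; rewrite (N0 c) eqxx.
have K1 : (1 : K0 N) = 0.
  apply: (@addrI _ 1); rewrite addr0.
  rewrite -(rmorph1 (@to_groth (defclass N))) -raddfD; congr to_groth; exact: e.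
by move=> y; rewrite -[y]mul1r K1 mul0r.
Qed.

(** * The induced homomorphism of Grothendieck rings *)

Section ClassRestriction.
Variables (R : pzRingType) (N M : lmodType R^c) (i : {linear N -> M}).
Hypothesis i_pure : pure i.
Hypothesis M_power : theory M = theory (cpower M).

Definition defclass_trace (a : defclass M) : K0 N :=
  K0_trace i (tagged (repr a)).

Lemma defclass_traceE n (A : defset M n.+1) :
  defclass_trace (class_of A) = K0_trace i A.
Proof.
apply: K0_trace_iso => //; apply/class_ofP; rewrite -[RHS]reprK.
by case: (repr _).
Qed.

Lemma defclass_trace_nmod : nmod_morphism defclass_trace.
Proof.
split=> [|a b].
  by rewrite -[0]/(class_of (defset0 M 1)) defclass_traceE K0_trace0.
(* Disjoint representatives need a nonzero element of [M]. If [M] is zero, so is [N], and the target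
   ring is trivial. *)
have [M1|M0] := pselect (exists c : M, c != 0); last first.
  have N0 (x : N) : x = 0.
    case: i_pure => iI _; apply: iI; rewrite linear0.
    by apply/eqP/negPn/negP => ix; apply: M0; exists (i x).
  by rewrite [LHS](trivial_K0 N0) [RHS](trivial_K0 N0).
have [n [A [B [-> -> AB]]]] := class_disjoint a b M1.
rewrite -[_ + _ in LHS]/(class_add (class_of A) (class_of B)) class_addE //.
by rewrite !defclass_traceE K0_traceU //; apply: defsetP.
Qed.

Lemma defclass_trace_monoid : monoid_morphism defclass_trace.
Proof.
split=> [|a b].
  rewrite -[1 in LHS]/(class_of (defset1 (0 : 'rV[M]_1))) defclass_traceE.
  rewrite K0_trace_ppcoset //; first exact: trace_class_set1.
  exact: ppcoset_set1.
have [n [A ->]] := class_of_surj a; have [m [B ->]] := class_of_surj b.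
rewrite -[_ * _ in LHS]/(class_mul (class_of A) (class_of B)) class_mulE.
rewrite (@defclass_traceE (n + m.+1)) !defclass_traceE.
by apply: K0_traceX => //; apply: defsetP.
Qed.

Lemma K0_trace_ppset n (f : ppformula R n.+1) :
  K0_trace i (ppset M f) = class_in_K0 (ppset N f).
Proof.
have sf := ppset_subgroup M f.
have fP : coset_of (ppset M f) (ppset M f).
  move=> x fx y; split=> [fy|fyx]; first exact: (proj2 sf).
  by rewrite -[y](subrK x); apply: subgroupD.
rewrite K0_trace_ppcoset //; last by exists f.
by apply: (trace_classE i_pure fP (x := 0)); case: sf.
Qed.

End ClassRestriction.

(** The second clause makes precise that [I] is induced by [i]. It determines [I], since the classes
    of pp-subgroups generate [K0 M] additively. *)
Theorem theorem6p1p1 (R : pzRingType) (N M : lmodType R^c)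
    (i : {linear N -> M}) (i_pure : pure i)
    (M_power : theory M = theory (cpower M)) :
  exists I : {rmorphism K0 M -> K0 N},
    (forall y : K0 N, exists x : K0 M, I x = y) /\
    (forall (n : nat) (A : defset M n.+1) (B : defset N n.+1),
       ppdefinable (A : set 'rV[M]_n.+1) ->
       (B : set 'rV[N]_n.+1) = map_mx i @^-1` A ->
       I (K0_class A) = K0_class B).
Proof.
have [I IE] := groth_extend (defclass_trace_nmod i_pure M_power)
  (defclass_trace_monoid i_pure M_power).
have IA n (A : defset M n.+1) : I (K0_class A) = K0_trace i A.
  by rewrite /K0_class IE defclass_traceE.
exists I; split; last first.
  move=> n A B [f fA] BA; rewrite IA fA K0_trace_ppset // -class_in_K0E BA fA.
  by case: i_pure => _ ->.
(* The image is an additive subgroup, so by [definable_ind] in [N] it is enough to reach the classes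
   of pp-cosets of [N]. *)
pose img : set (K0 N) := [set y | exists x, I x = y].
have imgB u v : img u -> img v -> img (u - v).
  by move=> [x <-] [y <-]; exists (x - y); rewrite rmorphB.
have img0 : img 0 by exists 0; rewrite rmorph0.
have imgD u v : img u -> img v -> img (u + v).
  move=> hu hv; have -> : u + v = u - (0 - v) by rewrite sub0r opprK.
  exact: (imgB _ _ hu (imgB _ _ img0 hv)).
have imgA n (A : set 'rV[N]_n.+1) : definable A -> img (class_in_K0 A).
  move=> dA; suff [] : definable A /\ img (class_in_K0 A) by [].
  apply: (definable_ind (Q := fun X => definable X /\ img (class_in_K0 X))
    (good := fun=> True) dA) => //.
  - by rewrite class_in_K0_0; split=> //; apply: definable0.
  - move=> X Y _ XY [dX hX] [dY hY]; rewrite class_in_K0U //.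
    by split; [apply: definableU|apply: (imgD)].
  - move=> X Y _ YX [dX hX] [dY hY]; rewrite class_in_K0D //.
    by split; [apply: definableD|apply: imgB].
  move=> C pC _; split; first exact: ppcoset_definable.
  have [->|/set0P[x Cx]] := eqVneq C set0; first by rewrite class_in_K0_0.
  have [f fC] := pC; have dC := ppcoset_definable pC.
  have df := ppset_definable N f.
  have Cf : class_in_K0 C = class_in_K0 (ppset N f).
    apply: class_in_K0_iso => //.
    by rewrite (coset_of_eq fC Cx); apply: defiso_translate.
  (* A nonempty pp-coset of [N] is a translate of the subgroup defined by [f], whose class comes
     from the subgroup of [M] defined by the same formula. *)
  exists (K0_class (DefSet (ppset_definable M f))).
  by rewrite IA Cf K0_trace_ppset.
move=> y; rewrite [y]gdiffE gdiff_sub.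
have [n [A ->]] := class_of_surj (repr y).1.
have [m [B ->]] := class_of_surj (repr y).2.
by apply: imgB; rewrite -/(K0_class _) -class_in_K0E; apply/imgA/defsetP.
Qed.
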